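(* There are (abstractly) simple groups with a spherical BN-pair of rank $2$ which are non-Moufang and hence not of algebraic origin. That is, there exist a generalized $n$-gon $\Gamma$ (for some $n$) and a simple group $G$ acting strongly transitively on $\Gamma$ such that $\Gamma$ does not satisfy the Moufang condition. Hence this BN-pair of $G$ is not of algebraic origin: it does not arise from the standard BN-pair of an essentially simple algebraic group, and $G$ is a simple non-algebraic group with a (non-split) BN-pair of rank $2$.
   Context: A generalized $n$-gon is a bipartite graph $\Gamma$ of diameter $n$ and girth $2n$. The type of a vertex is the class of the bipartition containing it. For a vertex $x$, $D_i(x)$ denotes the set of vertices at graph distance $i$ from $x$. A group $G$ acts strongly transitively on $\Gamma$ if it acts transitively on the set of $2n$-cycles of $\Gamma$ with chosen starting point of fixed type or, equivalently, if for any simple path $\gamma=(x_0,\ldots,x_n)$ in $\Gamma$ the pointwise stabilizer $G_\gamma$ acts transitively on $D_1(x_n)\setminus\{x_{n-1}\}$. A group $G$ has a spherical BN-pair of rank $2$ if and only if there is a generalized $n$-gon $\Gamma$ and a strongly transitive action of $G$ on $\Gamma$; this is taken as the definition. A generalized $n$-gon $\Gamma$ satisfies the Moufang condition if, writing $H=\mathrm{Aut}(\Gamma)$ and $H_{D_1(x_i)}$ for the pointwise stabilizer of $D_1(x_i)$ in $H$, for any simple path $(x_0,\ldots,x_n)$ in $\Gamma$ the group $\bigcap_{i=1}^{n-1}H_{D_1(x_i)}$ acts transitively on $D_1(x_n)\setminus\{x_{n-1}\}$. By the classification of Tits and Weiss, any Moufang polygon arises from the standard BN-pair of an essentially simple algebraic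 group; ''of algebraic origin'' refers to arising in this way. *)

(* Defs.v *)
From HB Require Import structures.
From mathcomp Require Import all_boot.
From mathcomp Require Import classical_sets.

Set Implicit Arguments.
Unset Strict Implicit.
Unset Printing Implicit Defensive.

Local Open Scope group_scope.
Local Open Scope classical_set_scope.

(* Vertices may form an infinite set. The bipartition is part of the data; for
   a connected graph it is determined up to exchanging the two classes. *)
Record bipartiteGraph := BipartiteGraph {
  vertex :> eqType;
  adj : rel vertex;
  vtype : vertex -> bool;
  adj_sym : symmetric adj;
  adj_vtype : forall x y, adj x y -> vtype x != vtype y }.

Arguments adj {b}.
Arguments vtype {b}.

Section Polygons.
Variable Gamma : bipartiteGraph.
Implicit Types (x y z : Gamma) (p c : seq Gamma) (n i : nat).

Definition walk i x y : Prop :=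
  exists p, [/\ path adj x p, last x p = y & size p = i].

(* [sphere i x] is D_i(x). *)
Definition sphere i x : set Gamma :=
  [set y | walk i x y /\ forall j, walk j x y -> (i <= j)%N].

Definition has_diameter n : Prop :=
  (forall x y, exists2 i, (i <= n)%N & sphere i x y) /\
  (exists x y, sphere n x y).

(* The bound 2 < size c excludes the degenerate closed walk x, y, x, which
   [ucycle] accepts for every edge xy. *)
Definition simple_cycle c : Prop := (2 < size c)%N /\ ucycle adj c.

Definition has_girth n : Prop :=
  (exists2 c, simple_cycle c & size c = n) /\
  (forall c, simple_cycle c -> (n <= size c)%N).

Definition generalized_gon n : Prop := has_diameter n /\ has_girth (2 * n)%N.

Definition automorphism (h : Gamma -> Gamma) : Prop :=
  bijective h /\ {mono h : x y / adj x y}.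

(* The simple path (x_0, ..., x_n) is x :: p, so x_i = nth x (x :: p) i. *)
Definition moufang n : Prop :=
  forall x p, path adj x p -> uniq (x :: p) -> size p = n ->
  forall y z,
    (sphere 1 (nth x (x :: p) n) `\ nth x (x :: p) n.-1) y ->
    (sphere 1 (nth x (x :: p) n) `\ nth x (x :: p) n.-1) z ->
  exists h, [/\ automorphism h,
    forall i, (0 < i < n)%N ->
      forall w, sphere 1 (nth x (x :: p) i) w -> h w = w
    & h y = z].

End Polygons.

Section Groups.
Variable G : groupType.
Implicit Types A B H N U : set G.

Definition subgroup H : Prop :=
  [/\ H 1, forall g h, H g -> H h -> H (g * h) & forall g, H g -> H g^-1].

Definition normalized_by U B : Prop := forall u b, U u -> B b -> U (u ^ b).

Definition simple_group : Prop :=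
  (exists g : G, g <> 1) /\
  forall N, subgroup N -> normalized_by N setT -> N = [set 1] \/ N = setT.

Definition generated A : set G :=
  [set g | forall H, subgroup H -> A `<=` H -> H g].

Fixpoint lower_central U k : set G :=
  if k is k'.+1 then
    generated [set g | exists a b, [/\ lower_central U k' a, U b & g = [~ a, b]]]
  else U.

Definition nilpotent_subgroup U : Prop :=
  subgroup U /\ exists k, lower_central U k = [set 1].

End Groups.

(* Not required to be faithful. *)
Record graphAction (G : groupType) (Gamma : bipartiteGraph) := GraphAction {
  act :> G -> Gamma -> Gamma;
  act1 : forall x, act 1 x = x;
  actM : forall g h x, act (g * h) x = act g (act h x);
  act_adj : forall g x y, adj (act g x) (act g y) = adj x y }.

Section Actions.
Variables (G : groupType) (Gamma : bipartiteGraph) (to : graphAction G Gamma).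
Implicit Types (x y z : Gamma) (p q c : seq Gamma) (n : nat).

(* A 2n-cycle with starting point x is listed as x :: p, in one of its two
   directions; transitivity is on these lists, with the type of x fixed. *)
Definition strongly_transitive n : Prop :=
  forall x p y q,
    simple_cycle (x :: p) -> size (x :: p) = (2 * n)%N ->
    simple_cycle (y :: q) -> size (y :: q) = (2 * n)%N ->
    vtype x = vtype y ->
  exists g, map (to g) (x :: p) = y :: q.

Definition flag_stabilizer x y : set G := [set g | to g x = x /\ to g y = y].

Definition apartment_stabilizer c : set G := [set g | map (to g) c =i c].

(* For an apartment (a 2n-cycle) containing the flag {x, y}, B is the
   stabilizer of the flag and N the setwise stabilizer of the apartment. The
   BN-pair is split if B = U (B `&` N) for some nilpotent normal subgroup U of
   B. If the action is strongly transitive, all choices of (x, y, p) give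
   conjugate BN-pairs. *)
Definition split_BN_pair n : Prop :=
  exists x y p,
    [/\ simple_cycle [:: x, y & p], size [:: x, y & p] = (2 * n)%N
      & let B := flag_stabilizer x y in
        let N := apartment_stabilizer [:: x, y & p] in
        exists U : set G,
          [/\ U `<=` B, normalized_by U B, nilpotent_subgroup U
            & forall b, B b -> exists u t, [/\ U u, (B `&` N) t & b = u * t]]].

End Actions.

(* Main.v *)
Require Import Defs.
From HB Require Import structures.
From mathcomp Require Import all_boot all_order all_algebra.
From mathcomp Require Import zify lra.
From mathcomp Require Import boolp classical_sets.

Set Implicit Arguments.
Unset Strict Implicit.
Unset Printing Implicit Defensive.

(* The polygon is a projective plane (n = 3), obtained as the union of an increasing sequence of
   bipartite graphs without 4-cycles, each with a group acting on it. From (H, S) the next pair is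
   constructed in three steps.
   - H acts on H x Q by left multiplication on H. In K = Sym(H x Q) every y in H lies in the normal
     closure of every x <> 1 in H. Replace (H, S) by (K, K x_H S).
   - Glue copies of the graph in a tree-like way, along all isomorphisms between finite subgraphs in
     which any two vertices of the same type have a common neighbour. In the amalgam these
     isomorphisms are induced by automorphisms; take the whole automorphism group.
   - Give every two vertices of the same type without a common neighbour a new common neighbour.
   The limit group is simple by the first step. By the second it is transitive on hexagons with a
   starting point of fixed type, and it permutes any five neighbours of a vertex as freely as
   possible, which a nilpotent normal subgroup of a flag stabilizer acting transitively does not
   allow. By the third the limit is a projective plane. Starting from a configuration that violates
   Desargues' theorem makes it non-Moufang. *)

Local Open Scope classical_set_scope.
Local Open Scope group_scope.

(** * Permutation groups and stages *)

Section Permutations.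
Variable T : Type.

Record permutation := Permutation {
  pfun :> T -> T;
  pinv : T -> T;
  pfunK : cancel pfun pinv;
  pinvK : cancel pinv pfun }.

Lemma permutation_ext (f g : permutation) : f =1 g -> f = g.
Proof.
case: f g => [f f' fK f'K] [g g' gK g'K] /= fg.
have fg' : f = g by apply: functional_extensionality_dep.
subst g.
have e' : f' = g'.
  by apply: functional_extensionality_dep => x; apply: (can_inj fK); rewrite f'K g'K.
by subst g'; congr Permutation; apply: Prop_irrelevance.
Qed.

Definition perm1 : permutation :=
  @Permutation id id (fun=> erefl) (fun=> erefl).

Definition permM (f g : permutation) : permutation :=
  Permutation (can_comp (pfunK f) (pfunK g)) (can_comp (pinvK g) (pinvK f)).

Definition permV (f : permutation) : permutation :=
  Permutation (pinvK f) (pfunK f).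

HB.instance Definition _ := gen_eqMixin permutation.
HB.instance Definition _ := gen_choiceMixin permutation.

Fact permMA : associative permM.
Proof. by move=> f g h; apply: permutation_ext. Qed.
Fact perm1M : left_id perm1 permM.
Proof. by move=> f; apply: permutation_ext. Qed.
Fact permM1 : right_id perm1 permM.
Proof. by move=> f; apply: permutation_ext. Qed.
Fact permVM : left_inverse perm1 permV permM.
Proof. by move=> f; apply: permutation_ext => x /=; rewrite pfunK. Qed.
Fact permMV : right_inverse perm1 permV permM.
Proof. by move=> f; apply: permutation_ext => x /=; rewrite pinvK. Qed.

HB.instance Definition _ :=
  isGroup.Build permutation permMA perm1M permM1 permVM permMV.

End Permutations.


Section PermutationSubgroups.
Variables (T : Type) (P : set (permutation T)) (sgP : subgroup P).

(** The proof that [P] is a subgroup is a parameter of the type, so that the group structure can be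
    inferred from the type alone. *)
Definition permutationGroup of subgroup P := {f : permutation T | P f}.
Local Notation pG := (permutationGroup sgP).

HB.instance Definition _ := gen_eqMixin pG.
HB.instance Definition _ := gen_choiceMixin pG.

Lemma pG_ext (f g : pG) : sval f =1 sval g -> f = g.
Proof.
case: f g => [f Pf] [g Pg] /= /permutation_ext fg.
by subst g; congr exist; apply: Prop_irrelevance.
Qed.

Let P1 : P 1 := let: And3 h _ _ := sgP in h.
Let PM f g : P f -> P g -> P (f * g) := let: And3 _ h _ := sgP in h f g.
Let PV f : P f -> P f^-1 := let: And3 _ _ h := sgP in h f.

Definition pG1 : pG := exist _ 1 P1.
Definition pGM (f g : pG) : pG := exist _ _ (PM (svalP f) (svalP g)).
Definition pGV (f : pG) : pG := exist _ _ (PV (svalP f)).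

Fact pGMA : associative pGM.
Proof. by move=> f g h; apply: pG_ext. Qed.
Fact pG1M : left_id pG1 pGM.
Proof. by move=> f; apply: pG_ext. Qed.
Fact pGM1 : right_id pG1 pGM.
Proof. by move=> f; apply: pG_ext. Qed.
Fact pGVM : left_inverse pG1 pGV pGM.
Proof. by move=> f; apply: pG_ext => x /=; rewrite pfunK. Qed.
Fact pGMV : right_inverse pG1 pGV pGM.
Proof. by move=> f; apply: pG_ext => x /=; rewrite pinvK. Qed.

HB.instance Definition _ := isGroup.Build pG pGMA pG1M pGM1 pGVM pGMV.

End PermutationSubgroups.

(** Incidence graphs of partial linear spaces: two distinct points lie on at most one common
    line. *)
Definition c4free (Gamma : bipartiteGraph) : Prop :=
  forall a a' b b' : Gamma,
    adj a b -> adj a b' -> adj a' b -> adj a' b' -> a = a' \/ b = b'.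

Record stage := Stage {
  sgraph :> bipartiteGraph;
  sgroup : groupType;
  sact : graphAction sgroup sgraph;
  sact_vtype : forall g x, vtype (sact g x) = vtype x;
  stage_c4free : c4free sgraph }.

Record stageHom (S S' : stage) := StageHom {
  hv :> S -> S';
  hg : sgroup S -> sgroup S';
  hv_inj : injective hv;
  hv_adj : {mono hv : x y / adj x y};
  hv_vtype : {mono hv : x / vtype x};
  hgM : {morph hg : g h / g * h};
  hv_act : forall g x, hv (sact S g x) = sact S' (hg g) (hv x) }.

Section Composition.
Variables (S S' S'' : stage) (f : stageHom S S') (f' : stageHom S' S'').
Definition compHom : stageHom S S''.
Proof.
refine (@StageHom S S'' (f' \o f) (hg f' \o hg f) _ _ _ _ _).
- exact: inj_comp (@hv_inj _ _ f') (@hv_inj _ _ f).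
- by move=> x y /=; rewrite !hv_adj.
- by move=> x /=; rewrite !hv_vtype.
- by move=> x y /=; rewrite !hgM.
- by move=> g x /=; rewrite !hv_act.
Defined.
End Composition.

Section Requirements.
Variables (S S' : stage) (f : stageHom S S').

Definition joins_pairs : Prop :=
  forall p q : S, p <> q -> vtype p = vtype q ->
  exists v, adj (f p) v /\ adj (f q) v.

Definition captures_elements : Prop :=
  forall (N : set (sgroup S')) (x y : sgroup S), subgroup N -> normalized_by N setT ->
  x <> 1 -> N (hg f x) -> N (hg f y).

End Requirements.

Section Matching.
Variable Gamma : bipartiteGraph.
Implicit Types s : seq Gamma.

Definition join_closed s : Prop :=
  forall a b, a \in s -> b \in s -> a <> b -> vtype a = vtype b ->
  exists v, [/\ v \in s, adj a v & adj b v].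

(* [matched s s'] says that s_i -> s'_i is an isomorphism between two induced subgraphs along which
   C4-free graphs can be glued: by [join_closed], no two vertices of the glued part acquire a
   second common neighbour. *)
Definition matched s s' : Prop :=
  [/\ uniq s, uniq s', size s = size s' & join_closed s /\ join_closed s'] /\
  forall x0 i j, (i < size s)%N -> (j < size s)%N ->
    vtype (nth x0 s i) = vtype (nth x0 s' i) /\
    adj (nth x0 s i) (nth x0 s j) = adj (nth x0 s' i) (nth x0 s' j).

End Matching.

Definition conjugates_matched (S S' : stage) (f : stageHom S S') : Prop :=
  forall s s' : seq S, matched s s' ->
  exists g, map (sact S' g) (map f s) = map f s'.

Lemma map_join_closed (Gamma Gamma' : bipartiteGraph) (f : Gamma -> Gamma') (s : seq Gamma) :
  {mono f : x y / adj x y} -> {mono f : x / vtype x} -> join_closed s -> join_closed (map f s).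
Proof.
move=> f_adj f_vtype cs a b /mapP[a' a's ->] /mapP[b' b's ->] ab.
rewrite !f_vtype => tab.
have [|v [vs av bv]] := cs a' b' a's b's _ tab; first by move=> e; apply: ab; rewrite e.
by exists (f v); rewrite map_f // !f_adj.
Qed.

Lemma map_matched (Gamma Gamma' : bipartiteGraph) (f : Gamma -> Gamma') (s s' : seq Gamma) :
  injective f -> {mono f : x y / adj x y} -> {mono f : x / vtype x} ->
  matched s s' -> matched (map f s) (map f s').
Proof.
move=> f_inj f_adj f_vtype [[us us' ss [cs cs']] m]; split.
  by split; rewrite ?map_inj_uniq ?size_map //; split; apply: map_join_closed.
move=> x0 i j; rewrite size_map => li lj.
case: s us ss cs m li lj => [//|z s] us ss cs m li lj.
by rewrite !(nth_map z) -?ss // !f_vtype !f_adj; apply: m.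
Qed.

(** * Free joins *)

Lemma actK (G : groupType) (Gamma : bipartiteGraph) (to : graphAction G Gamma) g :
  cancel (to g) (to g^-1).
Proof. by move=> x; rewrite -actM mulVg act1. Qed.

Lemma actVK (G : groupType) (Gamma : bipartiteGraph) (to : graphAction G Gamma) g :
  cancel (to g^-1) (to g).
Proof. by move=> x; rewrite -actM mulgV act1. Qed.

Section FreeJoins.
Variable S : stage.
Implicit Types (p q v : S) (g : sgroup S).
Local Notation to := (sact S).

(** A new vertex is the unordered pair that it joins, encoded as a set of vertices; the group then
    acts on new vertices by translating sets. *)
Definition unjoined (A : set S) : Prop :=
  exists p q, [/\ p <> q, vtype p = vtype q, forall v, ~ (adj p v /\ adj q v)
    & A = [set v | v = p \/ v = q]].

Definition newVertex := {A : set S | unjoined A}.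
HB.instance Definition _ := gen_eqMixin newVertex.

Definition join_vertex : eqType := (S + newVertex)%type.

Definition join_adj : rel join_vertex := fun x y =>
  match x, y with
  | inl p, inl q => adj p q
  | inl p, inr A | inr A, inl p => `[< sval A p >]
  | inr _, inr _ => false
  end.

Definition join_vtype (x : join_vertex) : bool :=
  match x with
  | inl p => vtype p
  | inr A => `[< exists p, sval A p /\ vtype p = false >]
  end.

Lemma newVertex_vtype (A : newVertex) p : sval A p -> join_vtype (inr A) = ~~ vtype p.
Proof.
case: A => A [a [b [ab tab nj eA]]] /= Ap.
have tp x : A x -> vtype x = vtype p.
  by move: Ap; rewrite eA /= => -[]-> []->; rewrite ?tab.
case tpE: (vtype p) => /=; first by apply/asboolP => -[x [/tp-> ]]; rewrite tpE.
by apply/asboolP; exists p.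
Qed.

Fact join_adj_sym : symmetric join_adj.
Proof. by case=> [p|A] [q|B] //=; apply: adj_sym. Qed.

Fact join_adj_vtype x y : join_adj x y -> join_vtype x != join_vtype y.
Proof.
case: x y => [p|A] [q|B] // h; first exact: adj_vtype.
  by rewrite (newVertex_vtype (asboolW h)) /=; case: vtype.
by rewrite (newVertex_vtype (asboolW h)) /=; case: vtype.
Qed.

Definition joinGraph := BipartiteGraph join_adj_sym join_adj_vtype.

Lemma unjoined_act g (A : set S) : unjoined A -> unjoined [set v | A (to g^-1 v)].
Proof.
case=> p [q [pq tpq nj ->]]; exists (to g p), (to g q); split.
- by move/(can_inj (actK to g)).
- by rewrite !sact_vtype.
- move=> v [pv qv]; apply: (nj (to g^-1 v)).
  by split; rewrite -(act_adj to g) actVK.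
- apply/predeqP => v /=; split.
    by case=> <-; rewrite actVK; [left|right].
  by case=> ->; rewrite actK; [left|right].
Qed.

Definition join_act g (x : joinGraph) : joinGraph :=
  match x with
  | inl p => inl (to g p)
  | inr A => inr (exist _ _ (unjoined_act g (svalP A)))
  end.

Lemma newVertex_ext (A B : newVertex) : (forall v, sval A v <-> sval B v) -> A = B.
Proof.
case: A B => [A hA] [B hB] /= AB.
have e : A = B by apply/predeqP.
by subst B; congr exist; apply: Prop_irrelevance.
Qed.

Fact join_act1 x : join_act 1 x = x.
Proof.
case: x => [p|A] /=; rewrite ?act1 //; congr inr; apply: newVertex_ext => v /=.
by rewrite invg1 act1.
Qed.

Fact join_actM g h x : join_act (g * h) x = join_act g (join_act h x).
Proof.
case: x => [p|A] /=; rewrite ?actM //; congr inr; apply: newVertex_ext => v /=.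
by rewrite invgM actM.
Qed.

Fact join_act_adj g x y : join_adj (join_act g x) (join_act g y) = join_adj x y.
Proof.
by case: x y => [p|A] [q|B] //=; rewrite ?act_adj ?actK.
Qed.

Definition joinAction : graphAction (sgroup S) joinGraph :=
  GraphAction join_act1 join_actM join_act_adj.

Fact join_act_vtype g (x : joinGraph) : vtype (joinAction g x) = vtype x.
Proof.
case: x => [p|A] /=; first exact: sact_vtype.
apply: asbool_equiv_eq; split=> -[p [Ap tp]].
  by exists (to g^-1 p); rewrite sact_vtype.
by exists (to g p); rewrite actK sact_vtype.
Qed.

Lemma newVertex_pair (A : newVertex) p q : sval A p -> sval A q -> p <> q ->
  (forall v, ~ (adj p v /\ adj q v)) /\ forall B : newVertex, sval B p -> sval B q -> A = B.
Proof.
have pairE (C : newVertex) : sval C p -> sval C q -> p <> q ->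
    (forall v, ~ (adj p v /\ adj q v)) /\ forall v, sval C v <-> v = p \/ v = q.
  case: C => C [a [b [ab tab nj eC]]] /=; rewrite eC /=.
  move=> [->|->] [->|->] // _; split=> // v; [|by split; case; auto].
  by move=> [? ?]; apply: (nj v).
move=> Ap Aq pq; have [nj eA] := pairE A Ap Aq pq; split=> // B Bp Bq.
have [_ eB] := pairE B Bp Bq pq.
by apply: newVertex_ext => v; rewrite eA eB.
Qed.

(** The neighbours of a new vertex A on a 4-cycle would be the two members of A. The vertex opposite
    to A is then a common neighbour of both: an old one is excluded by [unjoined], and a new one is
    A itself. *)
Fact join_c4free : c4free joinGraph.
Proof.
have key (p q : S) (A : newVertex) (y : joinGraph) : sval A p -> sval A q ->
    join_adj (inl p) y -> join_adj (inl q) y -> p = q \/ inr A = y.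
  move=> Ap Aq; have [->|/eqP pq] := eqVneq p q; first by left.
  have [nj uA] := newVertex_pair Ap Aq pq.
  case: y => [v|B] /= hp hq; first by case: (nj v).
  by right; congr inr; apply: uA; apply: asboolW.
case=> [p|A] [q|B] [y|C] [z|D] //=; rewrite /adj /=.
- by move=> h1 h2 h3 h4; case: (stage_c4free h1 h2 h3 h4) => ->; auto.
- move=> h1 /asboolP h2 h3 /asboolP h4.
  by case: (key p q D (inl y) h2 h4 h1 h3) => ->; auto.
- move=> /asboolP h1 h2 /asboolP h3 h4.
  by case: (key p q C (inl z) h1 h3 h2 h4) => ->; auto.
- move=> /asboolP h1 /asboolP h2 /asboolP h3 /asboolP h4.
  by case: (key p q C (inr D) h1 h3 (asboolT h2) (asboolT h4)) => ->; auto.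
- move=> h1 h2 /asboolP h3 /asboolP h4.
  by case: (key y z B (inl p) h3 h4); rewrite /= 1?adj_sym // => ->; auto.
- move=> /asboolP h1 /asboolP h2 h3 h4.
  by case: (key y z A (inl q) h1 h2); rewrite /= 1?adj_sym // => ->; auto.
- move=> /asboolP h1 /asboolP h2 /asboolP h3 /asboolP h4.
  by case: (key y z A (inr B) h1 h2); rewrite /= ?asboolE // => ->; auto.
Qed.

Definition joinStage := Stage join_act_vtype join_c4free.

Definition joinHom : stageHom S joinStage.
Proof.
exact: (@StageHom S joinStage (fun p => inl p) id (fun p q e => let: erefl := e in erefl)
  (fun=> fun=> erefl) (fun=> erefl) (fun=> fun=> erefl) (fun=> fun=> erefl)).
Defined.

Lemma joinHom_joins : joins_pairs joinHom.
Proof.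
move=> p q pq tpq.
have [[v [pv qv]]|nj] := pselect (exists v, adj p v /\ adj q v).
  by exists (inl v).
have uA : unjoined [set v | v = p \/ v = q].
  by exists p, q; split=> // v h; apply: nj; exists v.
by exists (inr (exist _ _ uA)); split; apply/asboolP; [left|right].
Qed.

End FreeJoins.

(** * Induced stages and normal closures *)

Section ClassicalQuotient.
Variables (T : Type) (R : T -> T -> Prop).

Definition quotient := {A : set T | exists x, A = R x}.
HB.instance Definition _ := gen_eqMixin quotient.

Definition class_of (x : T) : quotient := exist _ (R x) (ex_intro _ x erefl).

Definition class_repr (A : quotient) : T := sval (cid (svalP A)).

Lemma class_reprK A : class_of (class_repr A) = A.
Proof.
rewrite /class_repr; case: cid => x /= eA; case: A eA => A hA /= eA.
by subst A; congr exist; apply: Prop_irrelevance.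
Qed.

Hypotheses (Rxx : forall x, R x x) (Rsym : forall x y, R x y -> R y x)
  (Rtrans : forall x y z, R x y -> R y z -> R x z).

Lemma class_ofP x y : class_of x = class_of y <-> R x y.
Proof.
split=> [[e]|xy]; first by rewrite e; apply: Rxx.
have e : R x = R y.
  by apply/predeqP => z; split; [apply: Rtrans (Rsym xy)|apply: Rtrans xy].
rewrite /class_of; move: (ex_intro _ x _) (ex_intro _ y _); rewrite e => hx hy.
by congr exist; apply: Prop_irrelevance.
Qed.

End ClassicalQuotient.

(* The stage K x_H S, a disjoint union of copies of S indexed by K / H. *)
Section InducedStage.
Variables (S : stage) (K : groupType) (j : sgroup S -> K).
Hypotheses (jM : {morph j : g h / g * h}) (j_inj : injective j).
Implicit Types (p q : S) (g h : sgroup S) (k : K).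
Local Notation to := (sact S).

Let j1 : j 1 = 1.
Proof. by apply: (mulgI (j 1)); rewrite -jM !mulg1. Qed.
Let jV h : j h^-1 = (j h)^-1.
Proof. by apply: (mulgI (j h)); rewrite -jM !mulgV j1. Qed.

(** The balanced product relation (k h, p) ~ (k, h p). *)
Definition same_orbit (x y : K * S) : Prop :=
  exists h, x.1 = y.1 * j h /\ y.2 = to h x.2.

Definition ind_vertex := quotient same_orbit.
HB.instance Definition _ := Equality.on ind_vertex.
Definition ind_class k p : ind_vertex := class_of same_orbit (k, p).

Lemma ind_classP k p k' p' :
  ind_class k p = ind_class k' p' <-> exists h, k = k' * j h /\ p' = to h p.
Proof.
apply: class_ofP.
- by move=> x; exists 1; rewrite j1 mulg1 act1.
- by move=> [a u] [b v] [h [/= -> ->]]; exists h^-1; rewrite /= jV mulgK actK.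
- move=> [a u] [b v] [c w] [h [/= -> ->]] [h' [/= -> ->]].
  by exists (h' * h); rewrite /= jM mulgA actM.
Qed.

Lemma ind_class_surj (A : ind_vertex) : exists k p, A = ind_class k p.
Proof. by exists (class_repr A).1, (class_repr A).2; rewrite /ind_class -surjective_pairing class_reprK. Qed.

Lemma ind_class_inj k : injective (ind_class k).
Proof.
move=> p q /ind_classP[h []]; rewrite -{1}[k]mulg1 => /mulgI/esym.
by rewrite -j1 => /j_inj ->; rewrite act1.
Qed.

Definition ind_adj (A B : ind_vertex) : bool :=
  `[< exists k p q, [/\ A = ind_class k p, B = ind_class k q & adj p q] >].

(** Edges never leave a copy of [S]: changing the representative of an edge applies one element of
    the group to both ends, which preserves adjacency. *)
Lemma ind_adjP k p B :
  ind_adj (ind_class k p) B <-> exists q, B = ind_class k q /\ adj p q.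
Proof.
split=> [/asboolP[k0 [p0 [q0 [/ind_classP[h [-> ->]] -> pq]]]]|[q [-> pq]]]; last first.
  by apply/asboolP; exists k, p, q.
exists (to h^-1 q0); rewrite -(act_adj to h) actVK; split=> //.
by apply/ind_classP; exists h^-1; rewrite jV mulgK.
Qed.

Definition ind_vtype (A : ind_vertex) : bool := vtype (class_repr A).2.

Lemma ind_vtypeE k p : ind_vtype (ind_class k p) = vtype p.
Proof.
have := class_reprK (ind_class k p); rewrite /ind_vtype; case: (class_repr _) => k' p' /=.
rewrite -/(ind_class k' p') => /ind_classP[h [_ ->]].
by rewrite sact_vtype.
Qed.

Fact ind_adj_sym : symmetric ind_adj.
Proof.
move=> A B; apply/idP/idP => /asboolP[k [p [q [-> -> pq]]]]; apply/asboolP;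
by exists k, q, p; rewrite adj_sym.
Qed.

Fact ind_adj_vtype A B : ind_adj A B -> ind_vtype A != ind_vtype B.
Proof. by move=> /asboolP[k [p [q [-> -> pq]]]]; rewrite !ind_vtypeE adj_vtype. Qed.

Definition indGraph := BipartiteGraph ind_adj_sym ind_adj_vtype.

Definition ind_act k (A : indGraph) : indGraph := ind_class (k * (class_repr A).1) (class_repr A).2.

Lemma ind_actE k k' p : ind_act k (ind_class k' p) = ind_class (k * k') p.
Proof.
have := class_reprK (ind_class k' p); rewrite /ind_act; case: (class_repr _) => k0 p0 /=.
rewrite -/(ind_class k0 p0) => /ind_classP[h [-> ->]].
by apply/ind_classP; exists h; rewrite mulgA.
Qed.

Fact ind_act1 A : ind_act 1 A = A.
Proof. by have [k [p ->]] := ind_class_surj A; rewrite ind_actE mul1g. Qed.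

Fact ind_actM k k' A : ind_act (k * k') A = ind_act k (ind_act k' A).
Proof. by have [k0 [p ->]] := ind_class_surj A; rewrite !ind_actE mulgA. Qed.

Fact ind_act_adj k A B : ind_adj (ind_act k A) (ind_act k B) = ind_adj A B.
Proof.
have [k0 [p ->]] := ind_class_surj A; rewrite ind_actE.
apply/idP/idP => /ind_adjP[q [eB pq]]; apply/ind_adjP; exists q; split=> //.
  by rewrite -[B]ind_act1 -(mulVg k) ind_actM eB ind_actE mulKg.
by rewrite eB ind_actE.
Qed.

Definition indAction : graphAction K indGraph := GraphAction ind_act1 ind_actM ind_act_adj.

Fact ind_act_vtype k (A : indGraph) : vtype (indAction k A) = vtype A.
Proof. by have [k0 [p ->]] := ind_class_surj A; rewrite /= ind_actE /vtype /= !ind_vtypeE. Qed.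

Fact ind_c4free : c4free indGraph.
Proof.
move=> A A' B B'; have [k [p ->]] := ind_class_surj A.
move=> /ind_adjP[q [-> pq]] /ind_adjP[q' [-> pq']].
rewrite ![adj A' _]adj_sym => /ind_adjP[p' [-> p'q]] /ind_adjP[p'' [/ind_class_inj <- p'q']].
by rewrite adj_sym in p'q; rewrite adj_sym in p'q'; case: (stage_c4free pq pq' p'q p'q') => ->; auto.
Qed.

Definition indStage := Stage ind_act_vtype ind_c4free.

Definition indHom : stageHom S indStage.
Proof.
apply: (@StageHom S indStage (ind_class 1) j (@ind_class_inj 1)).
- move=> p q; apply/idP/idP => [/ind_adjP[q' [/ind_class_inj <- //]]|pq].
  by apply/ind_adjP; exists q.
- exact: ind_vtypeE.
- exact: jM.
- by move=> g p; rewrite /= ind_actE mulg1; apply/ind_classP; exists g^-1; rewrite actK jV mulgV.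
Defined.

End InducedStage.

Section RegularEmbedding.
Import Order.TTheory GRing.Theory Num.Theory.
Variable H : groupType.
Local Notation X := (H * rat)%type.
Local Notation K := (permutation X).
Local Open Scope ring_scope.

Definition left_regular (x : H) : K.
Proof.
refine (@Permutation X (fun p => ((x * p.1)%g, p.2)) (fun p => ((x^-1 * p.1)%g, p.2)) _ _).
- by case=> h a /=; rewrite mulKg.
- by case=> h a /=; rewrite mulVKg.
Defined.

Lemma left_regularM : {morph left_regular : x y / (x * y)%g}.
Proof. by move=> x y; apply: permutation_ext => -[h a] /=; rewrite mulgA. Qed.

Lemma left_regular_inj : injective left_regular.
Proof.
move=> x y /(congr1 (fun f : K => (f (1%g, 0)).1)) /=.
by rewrite !mulg1.
Qed.

Definition translation (f : H -> rat) : K.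
Proof.
refine (@Permutation X (fun p => (p.1, p.2 + f p.1)) (fun p => (p.1, p.2 - f p.1)) _ _).
- by case=> h a /=; rewrite addrK.
- by case=> h a /=; rewrite subrK.
Defined.

Definition dilation (d : H -> rat) (d_neq0 : forall h, d h != 0) : K.
Proof.
refine (@Permutation X (fun p => (p.1, d p.1 * p.2)) (fun p => (p.1, (d p.1)^-1 * p.2)) _ _).
- by case=> h a /=; rewrite mulKf.
- by case=> h a /=; rewrite mulVKf.
Defined.


Definition zpow (y : H) (n : int) : H :=
  (match n with Posz m => y ^+ m | Negz m => y ^- m.+1 end)%g.

Lemma zpowS y n : zpow y (n + 1) = (y * zpow y n)%g.
Proof.
case: n => [n|[|n]]; first by rewrite -PoszD addn1 /= expgS.
  by rewrite /= mulgV.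
have -> : Negz n.+1 + 1 = Negz n by rewrite !NegzE; lia.
by rewrite /= [in RHS]expgSr invgM mulVKg.
Qed.

Definition twist (y : H) : K.
Proof.
refine (@Permutation X (fun p => ((zpow y (Num.floor p.2) * p.1)%g, p.2))
   (fun p => (((zpow y (Num.floor p.2))^-1 * p.1)%g, p.2)) _ _).
- by case=> h a /=; rewrite mulKg.
- by case=> h a /=; rewrite mulVKg.
Defined.

(** Equality of the right cosets of h and h' modulo the cyclic group generated by x, written with
    natural exponents only. *)
Definition same_cycle (x h h' : H) : Prop :=
  exists m n : nat, (x ^+ m * h = x ^+ n * h')%g.

Lemma same_cycleP x h h' :
  class_of (same_cycle x) h = class_of (same_cycle x) h' <-> same_cycle x h h'.
Proof.
apply: class_ofP => [u|u v [m [n e]]|u v w [m [n e]] [m' [n' e']]].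
- by exists 0%N, 0%N.
- by exists n, m.
exists (m' + m)%N, (n + n')%N; rewrite !expgnDr -!mulgA e -e' !mulgA -!expgnDr.
by rewrite addnC.
Qed.

(** Every h is x^k r with r the representative of its coset; f h is a chosen exponent k. As h and x
    h have the same representative, equal exponents would give x h = h, that is x = 1. This also
    works when x has finite order. *)
Lemma moved_coloring (x : H) : x != 1%g -> exists f : H -> rat, forall h, f (x * h)%g != f h.
Proof.
move=> x1.
pose rep h := class_repr (class_of (same_cycle x) h).
have repP h : exists mn : nat * nat, (x ^+ mn.1 * h = x ^+ mn.2 * rep h)%g.
  have /same_cycleP[m [n e]] : class_of (same_cycle x) h = class_of (same_cycle x) (rep h).
    by rewrite /rep class_reprK.
  by exists (m, n).
have [c cP] := choice repP.
exists (fun h => (c h).2%:R - (c h).1%:R) => h; apply/eqP => e.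
have rE : rep (x * h)%g = rep h.
  by rewrite /rep; congr class_repr; apply/same_cycleP; exists 0%N, 1%N; rewrite mul1g expg1.
have := cP (x * h)%g; have := cP h; rewrite rE.
case: (c h) (c (x * h)%g) e => m n [m' n'] /= e e1 e2.
have {}e : (n' + m = n + m')%N.
  apply/eqP; rewrite -(eqr_nat rat) !natrD; apply/eqP; lra.
have : (x ^+ (n' + m) * h = x ^+ (n + m') * (x * h))%g.
  by rewrite !expgnDr -!mulgA e1 e2 !mulgA -!expgnDr addnC.
rewrite e => /mulgI/esym; rewrite -[RHS]mul1g => /mulIg ex.
by rewrite ex eqxx in x1.
Qed.

(* With s = (h, a) -> (h, a + f h), the commutator [x^-1 (s x s^-1)] is (h, a) -> (h, a + d h) where
   d h = f (x h) - f h is never 0; rescaling the second coordinate conjugates it to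
   z = (h, a) -> (h, a + 1), and [twist y] conjugates z to y z. *)
Lemma left_regular_captured (N : set K) (x y : H) :
  subgroup N -> normalized_by N setT ->
  x <> 1%g -> N (left_regular x) -> N (left_regular y).
Proof.
move=> [_ NM NV] Nn /eqP x1 Nx.
have [f fx] := moved_coloring x1.
have Nc (g n : K) : N n -> N (g * n * g^-1)%g.
  by move=> Nm; have := Nn n g^-1%g Nm I; rewrite conjgE invgK mulgA.
have d0 h : f (x * h)%g - f h != 0 by rewrite subr_eq0.
pose z := translation (fun=> 1).
pose s := translation f.
pose c : K := ((left_regular x)^-1 * (s * left_regular x * s^-1))%g.
have Ncc : N c by apply: NM; [apply: NV|apply: Nc].
have cE h a : c (h, a) = (h, a + (f (x * h)%g - f h)).
  by rewrite /= mulKg; congr pair; rewrite addrAC -addrA.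
have Nz : N z.
  pose D := dilation d0.
  have -> : z = (D^-1 * c * (D^-1)^-1)%g.
    apply: permutation_ext => -[h a]; rewrite invgK -[RHS]/(pinv D (c (D (h, a)))).
    by rewrite [D _]/= cE /= mulrDr mulKf // mulVf.
  exact: Nc.
have -> : left_regular y = (twist y * z * (twist y)^-1 * z^-1)%g.
  apply: permutation_ext => -[h a] /=.
  have -> : Num.floor (a - 1 + 1) = Num.floor (a - 1) + 1.
    by rewrite floorDrz ?rpred1 // floor1.
  by rewrite zpowS subrK -mulgA mulVKg.
by apply: NM; [apply: Nc|apply: NV].
Qed.

End RegularEmbedding.

Definition captureStage S :=
  @indStage S (permutation (sgroup S * rat)) _ (@left_regularM _) (@left_regular_inj _).

Definition captureHom S : stageHom S (captureStage S) :=
  indHom (@left_regularM _) (@left_regular_inj _).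

Lemma captureHom_captures S : captures_elements (captureHom S).
Proof. by move=> N x y; apply: left_regular_captured. Qed.

(** * Tree amalgams *)

Lemma matched_sym (Gamma : bipartiteGraph) (s s' : seq Gamma) :
  matched s s' -> matched s' s.
Proof.
case=> -[us us' e [cs cs']] m; split; first by split.
by move=> x0 i j; rewrite -e => li lj; have [-> ->] := m x0 i j li lj.
Qed.

Section TreeAmalgam.
Variable S : stage.
Implicit Types (p q : S) (h : sgroup S).
Local Notation to := (sact S).

(* Copies of S are indexed by reduced words. The copy at [l :: r] is glued to the copy at [r] by
   identifying [target l] (in the former) with [source l] (in the latter). A vertex of the amalgam
   is represented in the copy nearest to the root that contains it, which [canon] computes. *)
Definition letter := {l : seq S * seq S | matched l.1 l.2}.
HB.instance Definition _ := gen_eqMixin letter.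
Implicit Types (l m : letter) (r w : seq letter).

Definition source l := (sval l).1.
Definition target l := (sval l).2.

Definition linv l : letter := exist _ (target l, source l) (matched_sym (svalP l)).

Lemma letter_ext l m : source l = source m -> target l = target m -> l = m.
Proof.
case: l m => [[a b] hl] [[a' b'] hm] /= e e'; rewrite /source /target /= in e e'.
by subst a' b'; congr exist; apply: Prop_irrelevance.
Qed.

Lemma linvK : involutive linv.
Proof. by move=> l; apply: letter_ext. Qed.

(** The gluing isomorphism from [target l] onto [source l]; the default value of [nth] is not
    reached for p in [target l]. *)
Definition transport l p : S := nth p (source l) (index p (target l)).

Lemma size_letter l : size (source l) = size (target l).
Proof. by case: (svalP l) => -[]. Qed.

Lemma transport_in l p : p \in target l -> transport l p \in source l.
Proof. by move=> pt; rewrite mem_nth // size_letter index_mem. Qed.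

Lemma transportK l p : p \in target l -> transport (linv l) (transport l p) = p.
Proof.
move=> pt; have [[us _ _ _] _] := svalP l.
rewrite /transport /= index_uniq ?size_letter ?index_mem //.
by rewrite (set_nth_default p) ?index_mem // nth_index.
Qed.

Lemma transport_adj l p q : p \in target l -> q \in target l ->
  adj (transport l p) (transport l q) = adj p q.
Proof.
move=> pt qt; have [_ ml] := svalP l.
have lp : (index p (target l) < size (source l))%N by rewrite size_letter index_mem.
have lq : (index q (target l) < size (source l))%N by rewrite size_letter index_mem.
have [_] := ml p _ _ lp lq.
by rewrite -/(source l) -/(target l) !nth_index // (set_nth_default q p lq).
Qed.

Lemma transport_vtype l p : p \in target l -> vtype (transport l p) = vtype p.
Proof.
move=> pt; have [_ ml] := svalP l.
have lp : (index p (target l) < size (source l))%N by rewrite size_letter index_mem.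
by have [] := ml p _ _ lp lp; rewrite -/(source l) -/(target l) nth_index.
Qed.

(** Multiplication by a letter, with cancellation against the head of the list. A letter with equal
    source and target is its own inverse, so reduced words form a free product of cyclic groups,
    each infinite or of order 2. *)
Definition rmul r m : seq letter :=
  if r is l :: r' then if l == linv m then r' else m :: r else [:: m].

Fixpoint reduced r : bool :=
  if r is l :: r' then
    (if r' is l' :: _ then l' != linv l else true) && reduced r'
  else true.

Lemma reduced_tail l r : reduced (l :: r) -> reduced r.
Proof. by case/andP. Qed.

Lemma reduced_rmul r m : reduced r -> reduced (rmul r m).
Proof.
by case: r => [//|l r] rr /=; have [_|lm] := eqVneq l (linv m);
  [apply: reduced_tail rr|rewrite /= lm].
Qed.

Lemma rmul_reduced l r : reduced (l :: r) -> rmul r l = l :: r.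
Proof. by case: r => [//|l' r] /= /andP[/negPf-> ]. Qed.

Lemma rmulK r m : reduced r -> rmul (rmul r m) (linv m) = r.
Proof.
case: r => [|l r] rr /=; first by rewrite linvK eqxx.
have [lm|lm] := eqVneq l (linv m); last by rewrite /= linvK eqxx.
by rewrite -lm rmul_reduced.
Qed.

Fixpoint canon r p : seq letter * S :=
  if r is l :: r' then if p \in target l then canon r' (transport l p) else (r, p)
  else ([::], p).

(** The two descriptions of a glued vertex have the same normal form: one of the two words extends
    the other by one letter, so that one side unfolds to the other. *)
Lemma canon_glue r m p : p \in source m ->
  canon (rmul r m) (transport (linv m) p) = canon r p.
Proof.
move=> ps; have tm : transport (linv m) p \in target m by apply: transport_in.
have tK : transport m (transport (linv m) p) = p by rewrite -{1}[m]linvK transportK.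
case: r => [|l r] /=; first by rewrite tm tK.
by have [->|_] := eqVneq l (linv m); rewrite /= ?tm ?tK ?ps.
Qed.

Lemma canon_size r p : (size (canon r p).1 <= size r)%N.
Proof.
elim: r p => [//|l r IH] p /=; case: ifP => // _.
exact: leq_trans (IH _) (leqnSn _).
Qed.

Lemma canon_full r p : (size r <= size (canon r p).1)%N -> canon r p = (r, p).
Proof.
case: r => [//|l r] /=; case: ifP => // _ h.
by have := leq_trans h (canon_size r (transport l p)); rewrite ltnn.
Qed.

Lemma canon_id r p : canon (canon r p).1 (canon r p).2 = canon r p.
Proof. by elim: r p => [//|l r IH] p /=; case: ifP => [_|pl] //=; rewrite pl. Qed.

Lemma canon_reduced r p : reduced r -> reduced (canon r p).1.
Proof.
elim: r p => [//|l r IH] p rr /=; case: ifP => // _.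
exact: IH (reduced_tail rr).
Qed.

Lemma canon_vtype r p : vtype (canon r p).2 = vtype p.
Proof.
by elim: r p => [//|l r IH] p /=; case: ifP => // pl; rewrite IH transport_vtype.
Qed.

Lemma canon_inj r : injective (canon r).
Proof.
elim: r => [|l r IH] p q /=; first by case.
case: ifP => pl; case: ifP => ql.
- by move/IH => e; rewrite -(transportK pl) e transportK.
- by move=> e; have := canon_size r (transport l p); rewrite e ltnn.
- by move=> e; have := canon_size r (transport l q); rewrite -e ltnn.
- by case.
Qed.

Definition canonical (x : seq letter * S) : bool := reduced x.1 && (canon x.1 x.2 == x).
Definition amalgam_vertex := {x | canonical x}.
HB.instance Definition _ := Equality.on amalgam_vertex.
Implicit Types x y : amalgam_vertex.

Definition word := {r : seq letter | reduced r}.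

Fact copy_subproof (r : word) p : canonical (canon (val r) p).
Proof. by rewrite /canonical canon_reduced ?(valP r) // canon_id eqxx. Qed.
Definition copy (r : word) p : amalgam_vertex := exist (fun z => canonical z) _ (copy_subproof r p).

Definition vword x : word := exist (fun r => reduced r) (val x).1 (proj1 (andP (valP x))).

Lemma copy_vword x : copy (vword x) (val x).2 = x.
Proof. by apply: val_inj => /=; case/andP: (valP x) => _ /eqP. Qed.

Definition depth x := size (val x).1.

Definition amalgam_adj x y : bool :=
  `[< exists (r : word) p q, [/\ x = copy r p, y = copy r q & adj p q] >].

Definition amalgam_vtype x : bool := vtype (val x).2.

Lemma copy_vtype (r : word) p : amalgam_vtype (copy r p) = vtype p.
Proof. exact: canon_vtype. Qed.

Fact amalgam_adj_sym : symmetric amalgam_adj.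
Proof.
move=> x y; apply/idP/idP => /asboolP[r [p [q [-> -> pq]]]]; apply/asboolP;
by exists r, q, p; rewrite adj_sym.
Qed.

Fact amalgam_adj_vtype x y : amalgam_adj x y -> amalgam_vtype x != amalgam_vtype y.
Proof. by move=> /asboolP[r [p [q [-> -> pq]]]]; rewrite !copy_vtype adj_vtype. Qed.

Definition amalgamGraph := BipartiteGraph amalgam_adj_sym amalgam_adj_vtype.

Lemma copy_adj (r : word) p q : adj p q -> amalgam_adj (copy r p) (copy r q).
Proof. by move=> pq; apply/asboolP; exists r, p, q. Qed.

(** An edge is pushed towards the root as long as both of its ends are glued to the next copy. When
    this stops, one end is in normal form, and the deeper end [x] is then in normal form too. *)
Lemma edge_copy x y : amalgam_adj x y -> (depth y <= depth x)%N ->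
  exists q, y = copy (vword x) q /\ adj (val x).2 q.
Proof.
have key r p q : reduced r -> adj p q -> exists r' p' q', [/\ reduced r', adj p' q',
     canon r p = canon r' p', canon r q = canon r' q'
   & canon r' p' = (r', p') \/ canon r' q' = (r', q')].
  elim: r p q => [|l r IH] p q rr pq.
    by exists [::], p, q; split=> //; left.
  case pl: (p \in target l); last by exists (l :: r), p, q; split=> //=; left; rewrite pl.
  case ql: (q \in target l); last by exists (l :: r), p, q; split=> //=; right; rewrite ql.
  rewrite /= pl ql; apply: IH; first exact: reduced_tail rr.
  by rewrite transport_adj.
move=> /asboolP[[r rr] [p [q [-> -> pq]]]] dxy.
have [r' [p' [q' [rr' p'q' ep eq c]]]] := key r p q rr pq.
have ex : canon r p = (r', p').
  rewrite ep; case: c => // cq; apply: canon_full.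
  by move: dxy; rewrite /depth /= eq cq ep.
exists q'; rewrite /= ex; split=> //.
by apply: val_inj => /=; rewrite ex.
Qed.

(** This makes each copy an induced subgraph. The word of the normal form of [q] is no longer than
    [r1], so [q] passes through the same gluings as [p], and gluings preserve adjacency. *)
Lemma canon_induced r p q r1 p1 q1 : canon r p = (r1, p1) -> canon r q = canon r1 q1 ->
  adj p1 q1 -> adj p q.
Proof.
elim: r p q => [|l r IH] p q /=; first by case=> <- <- [->].
case: ifP => [pl ep|pl [<- <-]] /=.
  have sr : (size (canon r1 q1).1 < (size r).+1)%N.
    by have := canon_size r (transport l p); rewrite ep; apply: leq_trans (canon_size _ _).
  case: ifP => [ql eq|_ e]; last by rewrite -e ltnn in sr.
  by move=> /(IH _ _ ep eq); rewrite transport_adj.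
by move/(@canon_inj (l :: r)) => ->.
Qed.

Lemma copy_induced (r : word) p q : amalgam_adj (copy r p) (copy r q) -> adj p q.
Proof.
wlog dqp : p q / (depth (copy r q) <= depth (copy r p))%N.
  move=> H a; case: (leqP (depth (copy r q)) (depth (copy r p))) => [|/ltnW] d.
    exact: H.
  by rewrite adj_sym; apply: H => //; rewrite amalgam_adj_sym.
move=> /edge_copy /(_ dqp) [q1 [/(congr1 val) /= e a]].
exact: canon_induced (surjective_pairing _) e a.
Qed.

Lemma copy_inj (r : word) : injective (copy r).
Proof. by move=> p q /(congr1 val) /canon_inj. Qed.

(** The copy of the deepest vertex [x] contains [y] and [y']. If one of these is as deep as [x], its
    edge to [x'] brings [x'] into the same copy, and [S] has no 4-cycle. Otherwise both are glued to
    the copy one step nearer to the root, where the gluing condition decides. *)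
Lemma deepest_c4free x x' y y' :
  (depth y <= depth x)%N -> (depth y' <= depth x)%N -> (depth x' <= depth x)%N ->
  amalgam_adj x y -> amalgam_adj x y' -> amalgam_adj x' y -> amalgam_adj x' y' ->
  x = x' \/ y = y'.
Proof.
move=> dy dy' dx' xy xy' x'y x'y'.
have [q [eq pq]] := edge_copy xy dy; have [q' [eq' pq']] := edge_copy xy' dy'.
have same_copy p' : x' = copy (vword x) p' -> x = x' \/ y = y'.
  move=> ex'; move: x'y x'y'; rewrite ex' eq eq' => /copy_induced p'q /copy_induced p'q'.
  case: (stage_c4free pq pq' p'q p'q') => [<-|->]; last by right.
  by left; rewrite copy_vword.
have top z c : z = copy (vword x) c -> amalgam_adj x' z -> (depth x <= depth z)%N ->
    x = x' \/ y = y'.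
  move=> ez x'z dz.
  have fz : val z = ((val x).1, c) by rewrite ez /=; apply: canon_full; rewrite ez in dz.
  have [||p' [ex' _]] := @edge_copy z x'; first by rewrite amalgam_adj_sym.
    exact: leq_trans dx' dz.
  apply: (same_copy p'); rewrite ex'; congr copy; apply: val_inj; by rewrite /= fz.
case: (leqP (depth x) (depth y)) => [|sy]; first exact: top eq x'y.
case: (leqP (depth x) (depth y')) => [|sy']; first exact: top eq' x'y'.
have [->|/eqP yy'] := eqVneq y y'; first by right.
have cx : canon (val x).1 (val x).2 = val x by case/andP: (valP x) => _ /eqP.
move: sy sy' cx pq pq'; rewrite eq eq' /depth /=.
case: (val x) => -[//|l r] p /=.
case: ifP => [ql _|_]; last by rewrite ltnn.
case: ifP => [ql' _|_]; last by rewrite ltnn.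
case: ifP => [_ e|pl _] pq pq'.
  by have := canon_size r (transport l p); rewrite e ltnn.
(* Here [q] and [q'] lie in [target l] and [p] does not. If they differ, they have a common
   neighbour inside [target l]; since [S] is C4-free, it would have to be [p]. *)
have [[_ _ _ [_ ct]] _] := svalP l.
have tqq' : vtype q = vtype q'.
  by move: (adj_vtype pq) (adj_vtype pq'); do 3!case: vtype.
have [|v [vl qv q'v]] := ct q q' ql ql' _ tqq'.
  by move=> e; apply: yy'; rewrite eq eq' e.
rewrite adj_sym in qv; rewrite adj_sym in q'v.
case: (stage_c4free pq pq' qv q'v) => [pv|e]; first by rewrite pv vl in pl.
by right; rewrite e.
Qed.

Fact amalgam_c4free : c4free amalgamGraph.
Proof.
move=> x x' y y' xy xy' x'y x'y'; rewrite /adj /= in xy xy' x'y x'y'.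
have := @deepest_c4free x x' y y'; have := @deepest_c4free x' x y y'.
have := @deepest_c4free y y' x x'; have := @deepest_c4free y' y x x'.
rewrite ![amalgam_adj y _]amalgam_adj_sym ![amalgam_adj y' _]amalgam_adj_sym.
move=> Hy' Hy Hx' Hx.
have [] : [\/ [/\ depth y <= depth x, depth y' <= depth x & depth x' <= depth x],
  [/\ depth y <= depth x', depth y' <= depth x' & depth x <= depth x'],
  [/\ depth x <= depth y, depth x' <= depth y & depth y' <= depth y]
  | [/\ depth x <= depth y', depth x' <= depth y' & depth y <= depth y']]%N.
  move: (depth x) (depth x') (depth y) (depth y') => a b c d.
  case: (leqP (maxn a b) (maxn c d)) => ?;
    [case: (leqP c d) => ?; [apply: Or44|apply: Or43]
    |case: (leqP a b) => ?; [apply: Or42|apply: Or41]]; split; lia.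
- by case=> *; apply: Hx.
- by case=> *; case: Hx' => // ->; auto.
- by case=> *; case: Hy => // ->; auto.
- by case=> *; case: Hy' => // ->; auto.
Qed.

Definition amalgam_automorphism : set (permutation amalgam_vertex) :=
  [set f | (forall x y, amalgam_adj (f x) (f y) = amalgam_adj x y)
         /\ (forall x, amalgam_vtype (f x) = amalgam_vtype x)].

Fact amalgam_automorphism_subgroup : subgroup amalgam_automorphism.
Proof.
split=> [//|f g [fa ft] [ga gt]|f [fa ft]]; split=> [x y|x].
- by rewrite /= fa ga.
- by rewrite /= ft gt.
- by rewrite -fa /= !pinvK.
- by rewrite -ft /= pinvK.
Qed.

Definition amalgamGroup := permutationGroup amalgam_automorphism_subgroup.
HB.instance Definition _ := Group.on amalgamGroup.

Definition amalgamAction : graphAction amalgamGroup amalgamGraph.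
Proof.
refine (@GraphAction amalgamGroup amalgamGraph (fun g => sval g) _ _ _) => //.
by move=> g x y; case: (svalP g) => ga _; apply: ga.
Defined.

Definition amalgamStage : stage.
Proof.
refine (@Stage amalgamGraph amalgamGroup amalgamAction _ amalgam_c4free).
by move=> g x; case: (svalP g) => _; apply.
Defined.

Lemma matched_act h s s' : matched s s' -> matched (map (to h) s) (map (to h) s').
Proof.
by apply: map_matched; [exact: can_inj (actK to h)|exact: act_adj|exact: sact_vtype].
Qed.

Definition lact h l : letter := exist _ (map (to h) (source l), map (to h) (target l))
  (matched_act h (svalP l)).

Lemma lact_linv h l : lact h (linv l) = linv (lact h l).
Proof. exact: letter_ext. Qed.

Lemma transport_lact h l p : p \in target l ->
  transport (lact h l) (to h p) = to h (transport l p).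
Proof.
move=> pt; have inj := can_inj (actK to h).
rewrite /transport /= index_map // (nth_map p) //.
by rewrite size_letter index_mem.
Qed.

Lemma lact1 l : lact 1 l = l.
Proof. by apply: letter_ext; rewrite /source /target /= (eq_map (act1 to)) map_id. Qed.

Lemma lactM g h l : lact (g * h) l = lact g (lact h l).
Proof. by apply: letter_ext; rewrite /source /target /= -map_comp (eq_map (actM to g h)). Qed.

(* The word of the copy to which the copy at [r] is moved by the automorphism that carries
   the root copy to the copy at [w] through [h]. *)
Definition move_word w h r := foldr (fun m r' => rmul r' (lact h m)) w r.

Lemma move_word_reduced w h r : reduced w -> reduced (move_word w h r).
Proof. by move=> rw; elim: r => //= m r; apply: reduced_rmul. Qed.

Lemma move_word_rmul w h r m : reduced w ->
  move_word w h (rmul r m) = rmul (move_word w h r) (lact h m).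
Proof.
move=> rw; case: r => [//|l r] /=; have [->|//] := eqVneq l (linv m).
by rewrite lact_linv -{2}[lact h m]linvK rmulK // move_word_reduced.
Qed.

Lemma move_word_comp w h w' h' r : reduced w -> reduced w' ->
  move_word w h (move_word w' h' r) = move_word (move_word w h w') (h * h') r.
Proof.
move=> rw rw'; elim: r => [//|m r IH] /=.
by rewrite move_word_rmul // IH lactM.
Qed.

Lemma move_word_id r : reduced r -> move_word [::] 1 r = r.
Proof.
elim: r => [//|m r IH] rr /=.
by rewrite IH ?(reduced_tail rr) // lact1 rmul_reduced.
Qed.

(** This makes moving well defined on the amalgam: [transport] is equivariant, and the images of two
    adjacent copies are glued along the translated letter [lact h l], so [canon_glue] applies at
    each step to the root. *)
Lemma canon_move w h r p : reduced w -> reduced r ->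
  canon (move_word w h (canon r p).1) (to h (canon r p).2) = canon (move_word w h r) (to h p).
Proof.
move=> rw; elim: r p => [//|l r IH] p rr; rewrite [canon _ p]/=; case: ifP => // pl.
rewrite IH ?(reduced_tail rr) // -transport_lact //=.
rewrite -(canon_glue _ (m := lact h l)) ?transportK //.
  by rewrite map_f.
by apply: transport_in; rewrite map_f.
Qed.

Fact move_subproof w h (rw : reduced w) x :
  canonical (canon (move_word w h (val x).1) (to h (val x).2)).
Proof.
rewrite /canonical canon_reduced ?canon_id ?eqxx // move_word_reduced //.
Qed.

Definition move (w : word) h x : amalgam_vertex :=
  exist (fun z => canonical z) _ (move_subproof h (valP w) x).

Definition move_index (w : word) h (r : word) : word :=
  exist (fun r => reduced r) _ (move_word_reduced h (val r) (valP w)).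

Lemma move_copy (w : word) h (r : word) p : move w h (copy r p) = copy (move_index w h r) (to h p).
Proof. by apply: val_inj => /=; rewrite canon_move //; [apply: (valP w)|apply: (valP r)]. Qed.

Definition nil_word : word := exist (fun r => reduced r) [::] isT.
Definition letter_word l : word := exist (fun r => reduced r) [:: l] isT.

Lemma move_comp (w : word) h (w' : word) h' x :
  move w h (move w' h' x) = move (move_index w h w') (h * h') x.
Proof.
rewrite -(copy_vword x) !move_copy actM; congr copy; apply: val_inj => /=.
by rewrite move_word_comp; [|apply: (valP w)|apply: (valP w')].
Qed.

Lemma move_id x : move nil_word 1 x = x.
Proof.
rewrite -{1}(copy_vword x) move_copy act1 -{3}(copy_vword x); congr copy; apply: val_inj => /=.
by rewrite move_word_id //; case/andP: (valP x).
Qed.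

Lemma move_adj (w : word) h x y : amalgam_adj x y -> amalgam_adj (move w h x) (move w h y).
Proof.
by move=> /asboolP[r [p [q [-> -> pq]]]]; rewrite !move_copy; apply: copy_adj; rewrite act_adj.
Qed.

Definition move_group (w : word) h (w' : word) h' (K : cancel (move w h) (move w' h'))
  (K' : cancel (move w' h') (move w h)) : amalgamGroup.
Proof.
exists (Permutation K K'); split=> [x y|x] /=.
  by apply/idP/idP; [rewrite -{2}[x]K -{2}[y]K|]; apply: move_adj.
by rewrite -(copy_vword x) move_copy !copy_vtype sact_vtype.
Defined.

Fact move_nilK h : cancel (move nil_word h) (move nil_word h^-1).
Proof.
move=> x; rewrite move_comp mulVg -[RHS]move_id; congr move; exact: val_inj.
Qed.

Fact move_nilVK h : cancel (move nil_word h^-1) (move nil_word h).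
Proof. by move=> x; have := move_nilK h^-1 x; rewrite invgK. Qed.

Fact move_letterK l : cancel (move (letter_word l) 1) (move (letter_word (linv l)) 1).
Proof.
move=> x; rewrite move_comp mulg1 -[RHS]move_id; congr move; apply: val_inj => /=.
by rewrite lact1 eqxx.
Qed.

Fact move_letterVK l : cancel (move (letter_word (linv l)) 1) (move (letter_word l) 1).
Proof. by move=> x; have := move_letterK (linv l) x; rewrite linvK. Qed.

Definition amalgamHom : stageHom S amalgamStage.
Proof.
apply: (@StageHom S amalgamStage (copy nil_word) (fun h => move_group (move_nilK h) (move_nilVK h))).
- exact: copy_inj.
- by move=> p q; apply/idP/idP; [apply: copy_induced|apply: copy_adj].
- by move=> p; apply: copy_vtype.
- move=> g h; apply: pG_ext => x; rewrite /= move_comp; congr move; exact: val_inj.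
- move=> g x; rewrite /= move_copy; congr copy; exact: val_inj.
Defined.

Lemma amalgamHom_conjugates : conjugates_matched amalgamHom.
Proof.
move=> s s' ss'; have [[us us' e _] _] := ss'.
have [es|[z _]] : s = [::] \/ exists z, z \in s.
  by clear; case: s => [|z t]; [left|right; exists z; rewrite mem_head].
  by exists 1; move: e; rewrite es; case: s' {ss' us'}.
(* In the copy at [[:: l]] the i-th vertex of [s] is identified with the i-th vertex of [s'] in the
   root copy. The automorphism carrying the root copy identically onto this copy therefore maps [s]
   to [s']. *)
pose l : letter := exist _ (s', s) (matched_sym ss').
exists (move_group (move_letterK l) (move_letterVK l)).
apply: (@eq_from_nth _ (copy nil_word z)); rewrite !size_map // => i li.
rewrite -map_comp !(nth_map z) -?e //= -/(copy nil_word _) move_copy act1.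
apply: val_inj => /=; rewrite mem_nth // /transport /target /source /= index_uniq //.
by congr pair; apply: set_nth_default; rewrite -e.
Qed.

End TreeAmalgam.

(** * Direct limits *)

Section HomTheory.
Variables (S S' : stage) (f : stageHom S S').

Lemma hg1 : hg f 1 = 1.
Proof. by apply: (mulgI (hg f 1)); rewrite -hgM !mulg1. Qed.

Lemma hgV g : hg f g^-1 = (hg f g)^-1.
Proof. by apply: (mulgI (hg f g)); rewrite -hgM !mulgV hg1. Qed.

Lemma hgJ g h : hg f (g ^ h) = hg f g ^ hg f h.
Proof. by rewrite !conjgE !hgM hgV. Qed.

Lemma preimage_subgroup (N : set (sgroup S')) :
  subgroup N -> subgroup [set g | N (hg f g)].
Proof.
case=> N1 NM NV; split=> [|g h Ng Nh|g Ng] /=; first by rewrite hg1.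
  by rewrite hgM; apply: NM.
by rewrite hgV; apply: NV.
Qed.

Lemma preimage_normal (N : set (sgroup S')) :
  normalized_by N setT -> normalized_by [set g | N (hg f g)] setT.
Proof. by move=> Nn u b Nu _ /=; rewrite hgJ; apply: Nn. Qed.

End HomTheory.

Section HomComposition.
Variables (S S' S'' : stage) (f : stageHom S S') (f' : stageHom S' S'').

Lemma comp_joins : joins_pairs f' -> joins_pairs (compHom f f').
Proof.
by move=> J p q pq tpq; apply: J; rewrite ?hv_vtype // => /hv_inj.
Qed.

Lemma comp_captures : captures_elements f -> captures_elements (compHom f f').
Proof.
move=> C N x y sN nN x1 Nx; apply: (C [set g | N (hg f' g)] x y _ _ x1 Nx).
  exact: preimage_subgroup.
exact: preimage_normal.
Qed.

Lemma comp_conjugates_l : conjugates_matched f -> conjugates_matched (compHom f f').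
Proof.
move=> C s s' /C[g e]; exists (hg f' g).
rewrite (map_comp f' f s') -e -!map_comp; apply: eq_map => v /=.
by rewrite hv_act.
Qed.

Lemma comp_conjugates_r : conjugates_matched f' -> conjugates_matched (compHom f f').
Proof.
move=> C s s' /(map_matched (@hv_inj _ _ f) (@hv_adj _ _ f) (@hv_vtype _ _ f))/C[g e]; exists g.
by rewrite (map_comp f' f s') -e -!map_comp.
Qed.

End HomComposition.

(** Each of the three properties survives the other two steps: capturing under later maps, joining
    under earlier maps, conjugation under both. *)
Definition nextStage (S : stage) : stage := joinStage (amalgamStage (captureStage S)).

Definition nextHom (S : stage) : stageHom S (nextStage S) :=
  compHom (compHom (captureHom S) (amalgamHom (captureStage S))) (joinHom _).

Lemma nextHom_joins S : joins_pairs (nextHom S).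
Proof. by apply/comp_joins/joinHom_joins. Qed.

Lemma nextHom_captures S : captures_elements (nextHom S).
Proof. by do 2!apply: comp_captures; apply: captureHom_captures. Qed.

Lemma nextHom_conjugates S : conjugates_matched (nextHom S).
Proof. by apply: comp_conjugates_l; apply: comp_conjugates_r; apply: amalgamHom_conjugates. Qed.

Definition idHom (S : stage) : stageHom S S :=
  @StageHom S S id id (fun _ _ => id) (fun _ _ => erefl) (fun _ => erefl) (fun _ _ => erefl)
    (fun _ _ => erefl).

Section DirectLimit.
Variable S0 : stage.

Definition stage_seq (n : nat) : stage := iter n nextStage S0.
Local Notation S_ := stage_seq.
Definition seqHom n : stageHom (S_ n) (S_ n.+1) := nextHom (S_ n).

(** The type of vertices varies with the stage; equalities between pairs (n, v) under iteration of
    [nextV] replace casts along equations between indices. *)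
Definition preVertex := {n : nat & S_ n}.
Definition preElement := {n : nat & sgroup (S_ n)}.
Definition preV n (v : S_ n) : preVertex := existT (fun n => S_ n : Type) n v.
Definition preG n (g : sgroup (S_ n)) : preElement :=
  existT (fun n => sgroup (S_ n) : Type) n g.
Definition nextV (x : preVertex) : preVertex := preV (seqHom _ (projT2 x)).
Definition nextG (x : preElement) : preElement := preG (hg (seqHom _) (projT2 x)).

Lemma preV_inj n : injective (@preV n).
Proof. by move=> u v; apply: Eqdep_dec.inj_pair2_eq_dec PeanoNat.Nat.eq_dec _ _ _ _. Qed.

Lemma preG_inj n : injective (@preG n).
Proof. by move=> u v; apply: Eqdep_dec.inj_pair2_eq_dec PeanoNat.Nat.eq_dec _ _ _ _. Qed.

Lemma nextV_inj : injective nextV.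
Proof.
move=> [n u] [m v] e; have := congr1 (@projT1 _ _) e; case=> /= nm; subst m.
by have /preV_inj/hv_inj -> : preV (seqHom n u) = preV (seqHom n v) := e.
Qed.

Lemma projT1_nextV a x : projT1 (iter a nextV x) = (a + projT1 x)%N.
Proof. by elim: a => [//|a IH] /=; rewrite IH. Qed.

Definition eventually_eq (x y : preVertex) : Prop :=
  exists a b, iter a nextV x = iter b nextV y.

Definition limVertex := quotient eventually_eq.
HB.instance Definition _ := Equality.on limVertex.
Definition embed n (v : S_ n) : limVertex := class_of eventually_eq (preV v).

Lemma lim_classP x y :
  class_of eventually_eq x = class_of eventually_eq y <-> eventually_eq x y.
Proof.
apply: class_ofP => [{}x|{}x {}y [a [b e]]|{}x {}y z [a [b e]] [c [d e']]].
- by exists 0%N, 0%N.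
- by exists b, a.
- by exists (c + a)%N, (b + d)%N; rewrite iterD e -iterD addnC iterD e' -iterD.
Qed.

Lemma embed_seqHom n v : embed (seqHom n v) = embed v.
Proof. by apply/lim_classP; exists 0%N, 1%N. Qed.

Lemma embed_inj n : injective (@embed n).
Proof.
move=> u v /lim_classP[a [b e]].
have := congr1 (@projT1 _ _) e; rewrite !projT1_nextV /= => /addIn ab; subst b.
have iinj c : injective (iter c nextV) by elim: c => [//|c IH] x y /nextV_inj/IH.
by move/iinj/preV_inj: e.
Qed.

Lemma embed_surj x : exists n (v : S_ n), x = embed v.
Proof. by rewrite -(class_reprK x); case: (class_repr x) => n v; exists n, v. Qed.

Lemma lift n a : exists phi : stageHom (S_ n) (S_ (a + n)),
  (forall v, embed (phi v) = embed v) /\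
  (forall g, iter a nextG (preG g) = preG (hg phi g)).
Proof.
elim: a => [|a [phi [IHv IHg]]]; first by exists (idHom _); split.
exists (compHom phi (seqHom (a + n))); split=> [v|g]; last by rewrite iterS IHg.
exact: etrans (embed_seqHom (phi v)) (IHv v).
Qed.

Lemma lift_leq n m : (n <= m)%N -> exists phi : stageHom (S_ n) (S_ m),
  (forall v, embed (phi v) = embed v) /\
  (forall g, iter (m - n) nextG (preG g) = preG (hg phi g)).
Proof. by move/subnK => <-; rewrite addnK; apply: lift. Qed.

Lemma common_stage m (s : seq limVertex) :
  exists n (t : seq (S_ n)), (m <= n)%N /\ s = map (@embed n) t.
Proof.
elim: s => [|x s [n [t [mn ->]]]]; first by exists m, [::].
have [k [v ->]] := embed_surj x.
have [phi [phiE _]] := lift_leq (leq_addl k n).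
have [psi [psiE _]] := lift_leq (leq_addr n k).
exists (k + n)%N, (psi v :: map phi t); split; first exact: leq_trans mn (leq_addl _ _).
by rewrite /= psiE -map_comp; congr cons; apply: eq_map => w /=; rewrite phiE.
Qed.

Definition lim_adj (x y : limVertex) : bool :=
  `[< exists n (u v : S_ n), [/\ x = embed u, y = embed v & adj u v] >].

Lemma embed_adj n (u v : S_ n) : lim_adj (embed u) (embed v) = adj u v.
Proof.
apply/idP/idP => [/asboolP[m [u' [v' [eu ev uv]]]]|uv]; last by apply/asboolP; exists n, u, v.
have [phi [phiE _]] := lift_leq (leq_addl m n).
have [psi [psiE _]] := lift_leq (leq_addr n m).
rewrite -phiE -psiE in eu; rewrite -phiE -psiE in ev.
by rewrite -(hv_adj phi) (embed_inj eu) (embed_inj ev) hv_adj.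
Qed.

Definition lim_vtype (x : limVertex) : bool := vtype (projT2 (class_repr x)).

Lemma embed_vtype n (v : S_ n) : lim_vtype (embed v) = vtype v.
Proof.
have := class_reprK (embed v); rewrite /lim_vtype; case: (class_repr _) => m u /=.
rewrite -/(embed u) => e.
have [phi [phiE _]] := lift_leq (leq_addl m n).
have [psi [psiE _]] := lift_leq (leq_addr n m).
by rewrite -phiE -psiE in e; rewrite -(hv_vtype phi) -(embed_inj e) hv_vtype.
Qed.

Fact lim_adj_sym : symmetric lim_adj.
Proof.
move=> x y; apply/idP/idP => /asboolP[n [u [v [-> -> uv]]]];
by rewrite embed_adj adj_sym.
Qed.

Fact lim_adj_vtype x y : lim_adj x y -> lim_vtype x != lim_vtype y.
Proof. by move=> /asboolP[n [u [v [-> -> uv]]]]; rewrite !embed_vtype adj_vtype. Qed.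

Definition limGraph := BipartiteGraph lim_adj_sym lim_adj_vtype.

Lemma lim_c4free : c4free limGraph.
Proof.
move=> a a' b b'; have [n [t [_]]] := common_stage 0 [:: a; a'; b; b'].
case: t => [|u [|u' [|v [|v' [|//]]]]] //= [-> -> -> ->].
rewrite /adj /= !embed_adj => h1 h2 h3 h4.
by case: (stage_c4free h1 h2 h3 h4) => ->; auto.
Qed.

Lemma lim_joined (x y : limGraph) : x <> y -> vtype x = vtype y ->
  exists z : limGraph, adj x z /\ adj y z.
Proof.
have [n [t [_]]] := common_stage 0 [:: x; y].
case: t => [|u [|v [|//]]] //= [-> ->]; rewrite /vtype /= !embed_vtype => uv tuv.
have [|w [uw vw]] := @nextHom_joins _ u v _ tuv; first by move=> e; apply: uv; rewrite e.
by exists (embed (w : S_ n.+1)); rewrite -(embed_seqHom u) -(embed_seqHom v) /adj /= !embed_adj.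
Qed.

(** An element and a vertex are brought to a common stage before acting. As a relation this involves
    no choice of the stage; independence of the stage follows from the equivariance of the maps
    between stages. *)
Definition lim_action_rel (c : preElement) (x y : limVertex) : Prop :=
  exists a n h (v : S_ n),
    [/\ iter a nextG c = preG h, x = embed v & y = embed (sact (S_ n) h v)].

Lemma lim_action_rel_fun c x y y' :
  lim_action_rel c x y -> lim_action_rel c x y' -> y = y'.
Proof.
move=> [a [n [h [v [e ex ->]]]]] [a' [n' [h' [v' [e' ex' ->]]]]].
wlog aa' : a n h v e ex a' n' h' v' e' ex' / (a <= a')%N.
  move=> H; case: (leqP a a') => [|/ltnW] /H; first exact.
  by move=> H'; apply/esym/(H' _ h' v' e' ex' _ h v).
have [phi [phiv phig]] := lift n (a' - a).
rewrite -(subnK aa') iterD e phig in e'.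
have := congr1 (@projT1 _ _) e' => /= en; subst n'.
move/preG_inj: e' => <-.
by rewrite -(phiv v) in ex; rewrite -(phiv _) hv_act; congr (embed (sact _ _ _));
  apply: embed_inj; rewrite -ex -ex'.
Qed.

Lemma lim_action_rel_total c x : exists y, lim_action_rel c x y.
Proof.
case: c => n g; have [m [t [nm]]] := common_stage n [:: x].
case: t => [|v [|//]] //= [->].
have [phi [_ phig]] := lift_leq nm.
by exists (embed (sact _ (hg phi g) v)), (m - n)%N, m, (hg phi g), v.
Qed.

Definition lim_fun c (x : limVertex) : limVertex := sval (cid (lim_action_rel_total c x)).

Lemma lim_funP c x y : lim_action_rel c x y -> lim_fun c x = y.
Proof. by apply: lim_action_rel_fun; rewrite /lim_fun; case: cid. Qed.

Lemma lim_fun_inj n g (v : S_ n) : lim_fun (preG g) (embed v) = embed (sact (S_ n) g v).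
Proof. by apply: lim_funP; exists 0%N, n, g, v. Qed.

Lemma lim_fun_next c : lim_fun (nextG c) = lim_fun c.
Proof.
apply: funext => x; apply/esym/lim_funP; rewrite /lim_fun; case: cid => y /=.
by case=> a [n [h [v [e -> ->]]]]; exists a.+1, n, h, v; rewrite iterSr.
Qed.

Lemma lim_fun_iter a c : lim_fun (iter a nextG c) = lim_fun c.
Proof. by elim: a => [//|a IH]; rewrite iterS lim_fun_next. Qed.

Lemma lim_fun_at n g m : (n <= m)%N ->
  exists h, lim_fun (@preG n g) = lim_fun (@preG m h).
Proof.
by move=> /lift_leq[phi [_ phig]]; exists (hg phi g); rewrite -phig lim_fun_iter.
Qed.

Lemma lim_funM n (g h : sgroup (S_ n)) x :
  lim_fun (preG (g * h)) x = lim_fun (preG g) (lim_fun (preG h) x).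
Proof.
have [m [t [nm]]] := common_stage n [:: x]; case: t => [|v [|//]] //= [->].
have [phi [_ phig]] := lift_leq nm.
have E (g' : sgroup (S_ n)) : lim_fun (preG g') = lim_fun (preG (hg phi g')).
  by rewrite -phig lim_fun_iter.
by rewrite !E !lim_fun_inj hgM actM.
Qed.

Lemma lim_fun1 n x : lim_fun (@preG n 1) x = x.
Proof.
have [m [t [nm]]] := common_stage n [:: x]; case: t => [|v [|//]] //= [->].
have [phi [_ phig]] := lift_leq nm.
by rewrite -(lim_fun_iter (m - n)) phig lim_fun_inj hg1 act1.
Qed.

Fact lim_funK n g : cancel (lim_fun (@preG n g)) (lim_fun (preG g^-1)).
Proof. by move=> x; rewrite -lim_funM mulVg lim_fun1. Qed.
Fact lim_funVK n g : cancel (lim_fun (@preG n g^-1)) (lim_fun (preG g)).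
Proof. by move=> x; rewrite -lim_funM mulgV lim_fun1. Qed.

Definition lim_perm n g : permutation limVertex := Permutation (@lim_funK n g) (@lim_funVK n g).

Lemma lim_permM n : {morph @lim_perm n : g h / g * h}.
Proof. by move=> g h; apply: permutation_ext => x; apply: lim_funM. Qed.

Lemma lim_perm1 n : @lim_perm n 1 = 1.
Proof. by apply: permutation_ext => x; apply: lim_fun1. Qed.

Lemma lim_permV n g : @lim_perm n g^-1 = (lim_perm g)^-1.
Proof. by apply: (mulgI (lim_perm g)); rewrite -lim_permM !mulgV lim_perm1. Qed.

Lemma lim_perm_next n g : lim_perm (hg (seqHom n) g) = lim_perm g.
Proof.
apply: permutation_ext => x.
by rewrite /= -[preG _]/(nextG (preG g)) lim_fun_next.
Qed.

Lemma lim_perm_at n g m : (n <= m)%N -> exists h, @lim_perm n g = @lim_perm m h.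
Proof.
move=> /(lim_fun_at g)[h e]; exists h.
by apply: permutation_ext => x; rewrite /= e.
Qed.

(** The group is taken inside the permutations of the limit, so that it acts faithfully: elements of
    a stage that act trivially on the limit become 1. *)
Definition lim_element : set (permutation limVertex) :=
  [set f | exists n g, f = @lim_perm n g].

Fact lim_element_subgroup : subgroup lim_element.
Proof.
split=> [|_ _ [n [g ->]] [m [h ->]]|_ [n [g ->]]].
- by exists 0%N, 1; rewrite lim_perm1.
- have [g' ->] := lim_perm_at g (leq_addl m n); have [h' ->] := lim_perm_at h (leq_addr n m).
  by exists (m + n)%N, (g' * h'); rewrite lim_permM.
- by exists n, g^-1; rewrite lim_permV.
Qed.

Definition limGroup := permutationGroup lim_element_subgroup.
HB.instance Definition _ := Group.on limGroup.

Lemma lim_perm_in n g : lim_element (@lim_perm n g).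
Proof. by exists n, g. Qed.

Definition lim_elt n g : limGroup := exist _ (@lim_perm n g) (lim_perm_in g).

Lemma lim_elt_surj (f : limGroup) m : exists n g, (m <= n)%N /\ f = @lim_elt n g.
Proof.
case: f => f [n [g fE]]; have [h hE] := lim_perm_at g (leq_addl m n).
exists (m + n)%N, h; split; first exact: leq_addr.
by apply: pG_ext => x /=; rewrite fE hE.
Qed.

Lemma lim_eltM n : {morph @lim_elt n : g h / g * h}.
Proof. by move=> g h; apply: pG_ext => x; rewrite /= lim_funM. Qed.

Lemma lim_elt_at n g m : (n <= m)%N -> exists h, @lim_elt n g = @lim_elt m h.
Proof.
move=> /(lim_perm_at g)[h e]; exists h; apply: pG_ext => x.
by rewrite -[LHS]/(lim_perm g x) e.
Qed.

Lemma lim_elt1 n : @lim_elt n 1 = 1.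
Proof. by apply: pG_ext => x; apply: lim_fun1. Qed.

Lemma lim_eltV n g : @lim_elt n g^-1 = (lim_elt g)^-1.
Proof. by apply: (mulgI (lim_elt g)); rewrite -lim_eltM !mulgV lim_elt1. Qed.

Lemma lim_elt_next n g : lim_elt (hg (seqHom n) g) = lim_elt g.
Proof. by apply: pG_ext => x; rewrite -[LHS]/(lim_perm _ x) lim_perm_next. Qed.

(** A nontrivial [x] in [N] and an arbitrary [y] come from a common stage, and in the next stage the
    normal closure of the image of [x] contains the image of [y]. *)
Lemma lim_normal_full (N : set limGroup) : subgroup N -> normalized_by N setT ->
  (exists2 x, N x & x <> 1) -> N = setT.
Proof.
move=> sN nN [x Nx x1]; apply/seteqP; split=> // y _.
have [n [gx [_ ex]]] := lim_elt_surj x 0.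
have [m [gy [nm ey]]] := lim_elt_surj y n.
have [gx' ex'] := lim_elt_at gx nm.
rewrite ex ex' in Nx x1.
rewrite ey -lim_elt_next.
have [N1 NM NV] := sN.
apply: (@nextHom_captures _ [set g | N (@lim_elt m.+1 g)] gx').
- split=> [|g h Ng Nh|g Ng] /=; rewrite ?lim_elt1 ?lim_eltM ?lim_eltV //; [exact: NM|exact: NV].
- move=> u b Nu _ /=.
  by rewrite conjgE !lim_eltM lim_eltV -conjgE; apply: nN.
- by move=> e; apply: x1; rewrite e lim_elt1.
- by rewrite /= lim_elt_next.
Qed.

Definition limAction : graphAction limGroup limGraph.
Proof.
refine (@GraphAction limGroup limGraph (fun g => sval g) _ _ _) => //.
move=> g x y; have [n [h [_ ->]]] := lim_elt_surj g 0.
have [m [t [nm]]] := common_stage n [:: x; y]; case: t => [|u [|v [|//]]] //= [-> ->].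
have [phi [_ phig]] := lift_leq nm.
rewrite -(lim_fun_iter (m - n)) phig !lim_fun_inj /adj /= !embed_adj.
exact: act_adj.
Defined.

Lemma limAction_vtype g (x : limGraph) : vtype (limAction g x) = vtype x.
Proof.
have [n [h [_ ->]]] := lim_elt_surj g 0.
have [m [t [nm]]] := common_stage n [:: x]; case: t => [|u [|//]] //= [->].
have [phi [_ phig]] := lift_leq nm.
rewrite -(lim_fun_iter (m - n)) phig !lim_fun_inj /vtype /= !embed_vtype.
exact: sact_vtype.
Qed.

Lemma embed_closed n (t : seq (S_ n)) :
  join_closed (map (@embed n) t : seq limGraph) -> join_closed t.
Proof.
move=> ct a b at_ bt ab tab.
have [||v [/mapP[w wt ->]]] := ct _ _ (map_f _ at_) (map_f _ bt).
- by move=> /embed_inj.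
- by rewrite /vtype /= !embed_vtype.
by rewrite /adj /= !embed_adj => aw bw; exists w.
Qed.

Lemma embed_matched n (t t' : seq (S_ n)) :
  matched (map (@embed n) t : seq limGraph) (map (@embed n) t') -> matched t t'.
Proof.
move=> [[us us' ss [/embed_closed cs /embed_closed cs']] m]; split.
  by rewrite !(map_inj_uniq (@embed_inj n)) ?size_map in us us' ss.
rewrite !size_map in ss m => x0 i j li lj; have := m (embed x0) i j li lj.
by rewrite !(nth_map x0) -?ss // /vtype /adj /= !embed_vtype !embed_adj.
Qed.

(** Two finite sequences live in a single stage, where they are still matched; the next stage
    contains the required element. *)
Lemma lim_conjugates (s s' : seq limGraph) : matched s s' ->
  exists g, map (limAction g) s = s'.
Proof.
have [n [t [_ eS]]] := common_stage 0 (s ++ s').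
have es : s = map (@embed n) (take (size s) t) by rewrite map_take -eS take_size_cat.
have es' : s' = map (@embed n) (drop (size s) t) by rewrite map_drop -eS drop_size_cat.
rewrite es es' => /embed_matched/(@nextHom_conjugates (S_ n))[g e].
exists (@lim_elt n.+1 g).
rewrite -[RHS](eq_map (@embed_seqHom n)) (map_comp (@embed n.+1) (seqHom n)).
apply: etrans (congr1 (map (@embed n.+1)) e); rewrite -!map_comp; apply: eq_map => v /=.
by rewrite -(embed_seqHom v) lim_fun_inj.
Qed.

End DirectLimit.

(** * Projective planes *)

Section BipartiteGraphs.
Variable Gamma : bipartiteGraph.
Implicit Types (x y z : Gamma) (l p c : seq Gamma).

Lemma adj_same_type x y : vtype x = vtype y -> adj x y = false.
Proof. by move=> t; apply/negP => /adj_vtype; rewrite t eqxx. Qed.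

Lemma adj_vtypeE x y : adj x y -> vtype y = ~~ vtype x.
Proof. by move=> /adj_vtype; do 2!case: vtype. Qed.

Lemma adj_irrefl x : adj x x = false.
Proof. exact: adj_same_type. Qed.

Lemma walk_vtype i x y : walk i x y -> vtype y = vtype x (+) odd i.
Proof.
case=> p [+ <- <-]; elim: p x => [|z p IH] x /=; first by rewrite addbF.
by case/andP => /adj_vtypeE t /IH ->; rewrite t addbN addNb.
Qed.

Lemma walk_sphere i x y : walk i x y -> exists2 j, (j <= i)%N & sphere j x y.
Proof.
move=> w; have ex : exists j, `[< walk j x y >] by exists i; apply/asboolP.
case: (ex_minnP ex) => j /asboolP wj jmin.
by exists j; [apply/jmin/asboolP|split=> // k wk; apply/jmin/asboolP].
Qed.

Lemma walk0 x y : walk 0 x y -> y = x.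
Proof. by case=> -[|z p] [] //= _ <-. Qed.

Lemma walk1 x y : walk 1 x y -> adj x y.
Proof. by case=> -[|z [|z' p]] [] //=; rewrite andbT => + <-. Qed.

Lemma sphere1 x y : sphere 1 x y <-> adj x y.
Proof.
split=> [[/walk1]//|xy]; split.
  by exists [:: y]; rewrite /= xy.
by case=> // /walk0 e; rewrite e adj_irrefl in xy.
Qed.

(** The centre of a star is a common neighbour of all leaves, and leaves, having the same type, are
    never adjacent. Thus any bijection between the leaves may be glued along, and the neighbours of
    a vertex can be permuted freely. *)
Lemma star_matched x x' l l' : vtype x = vtype x' -> uniq l -> uniq l' ->
  all (adj x) l -> all (adj x') l' -> size l = size l' -> matched (x :: l) (x' :: l').
Proof.
move=> txx' ul ul' /allP al /allP al' e.
have uq z m : uniq m -> {in m, forall a, adj z a} -> uniq (z :: m).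
  by move=> um am; rewrite /= um andbT; apply/negP => /am; rewrite adj_irrefl.
have jc z m : {in m, forall a, adj z a} -> join_closed (z :: m).
  move=> am a b; rewrite !inE => /predU1P[->|/am za] /predU1P[->|/am zb] ab tab //.
  - by rewrite adj_same_type in zb.
  - by rewrite adj_same_type in za.
  - by exists z; rewrite mem_head ![adj _ z]adj_sym.
split; first by split; rewrite /= ?e //; [apply: uq|apply: uq|split; apply: jc].
have tl x0 i : (i < size l)%N -> adj x (nth x0 l i) /\ vtype (nth x0 l i) = ~~ vtype x.
  by move=> li; have h := al _ (mem_nth x0 li); split=> //; apply: adj_vtypeE.
have tl' x0 i : (i < size l)%N -> adj x' (nth x0 l' i) /\ vtype (nth x0 l' i) = ~~ vtype x'.
  by rewrite e => li; have h := al' _ (mem_nth x0 li); split=> //; apply: adj_vtypeE.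
move=> x0 [|i] [|j] //=; rewrite ?ltnS.
- by rewrite !adj_irrefl.
- by move=> _ /[dup]/(tl x0)[-> _] /(tl' x0)[-> _].
- move=> /[dup]/(tl x0)[a ->] /(tl' x0)[a' ->] _.
  by rewrite txx' ![adj _ x]adj_sym ![adj _ x']adj_sym a a'.
- move=> /[dup]/(tl x0)[_ t] /(tl' x0)[_ t'] /[dup]/(tl x0)[_ u] /(tl' x0)[_ u'].
  by rewrite t t' txx' !adj_same_type ?t ?t' ?u ?u'.
Qed.

Section ProjectivePlanes.
Hypothesis c4 : c4free Gamma.

Lemma unique_neighbor x y a b : x <> y -> adj x a -> adj x b -> adj y a -> adj y b -> a = b.
Proof. by move=> xy h1 h2 h3 h4; case: (c4 h1 h2 h3 h4). Qed.

Lemma simple_cycle_size c : simple_cycle c -> (6 <= size c)%N.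
Proof.
case=> + /andP[cc uc].
have ev : ~~ odd (size c).
  case: c cc {uc} => [//|x p] cc.
  have /walk_vtype : walk (size (x :: p)) x x.
    by exists (rcons p x); rewrite last_rcons size_rcons.
  by case: odd; case: vtype.
case: c cc uc ev => [|x0 [|x1 [|x2 [|x3 [|x4 [|x5 c]]]]]] //=.
rewrite andbT => /and4P[h01 h12 h23 h30] + _ _; rewrite !inE.
case: (c4 (a := x0) (a' := x2) (b := x1) (b' := x3)) => //.
- by rewrite adj_sym.
- by rewrite adj_sym.
- by move=> <-; rewrite eqxx !orbT.
- by move=> <-; rewrite eqxx !orbT andbF.
Qed.

Definition hexagon x0 x1 x2 x3 x4 x5 : Prop :=
  [/\ adj x0 x1, adj x1 x2 & adj x2 x3] /\ [/\ adj x3 x4, adj x4 x5 & adj x5 x0] /\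
  uniq [:: x0; x1; x2; x3; x4; x5].

Lemma simple_hexagon c : simple_cycle c -> size c = 6 ->
  exists x0 x1 x2 x3 x4 x5, c = [:: x0; x1; x2; x3; x4; x5] /\ hexagon x0 x1 x2 x3 x4 x5.
Proof.
case=> _ /andP[+ uc].
case: c uc => [|x0 [|x1 [|x2 [|x3 [|x4 [|x5 [|//]]]]]]] //= uc.
rewrite andbT => /and5P[h1 h2 h3 h4 /andP[h5 h6]] _.
by exists x0, x1, x2, x3, x4, x5.
Qed.

(** A long diagonal would close a 4-cycle with three sides of the hexagon. *)
Lemma hexagon_diagonal x0 x1 x2 x3 x4 x5 : hexagon x0 x1 x2 x3 x4 x5 ->
  [/\ adj x0 x3 = false, adj x1 x4 = false & adj x2 x5 = false].
Proof.
case=> -[h01 h12 h23] [[h34 h45 h50] /and5P[n0 n1 n2 n3 _]].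
have diag (a b a' b' : Gamma) : adj a b -> adj b a' -> adj a' b' -> a <> a' -> b <> b' ->
    adj a b' = false.
  move=> ab ba' a'b' aa' bb'; apply/negP => ab'.
  by rewrite adj_sym in ba'; case: (c4 ab ab' ba' a'b').
rewrite !inE !negb_or in n0 n1 n2 n3.
case/and5P: n0 => _ /eqP n02 _ _ _; case/and4P: n1 => _ /eqP n13 _ _.
case/and3P: n2 => _ /eqP n24 _; case/andP: n3 => _ /eqP n35.
by split; [apply: diag h01 h12 h23 _ _|apply: diag h12 h23 h34 _ _|apply: diag h23 h34 h45 _ _].
Qed.

Lemma hexagon_adj x0 x1 x2 x3 x4 x5 d : hexagon x0 x1 x2 x3 x4 x5 ->
  let c := [:: x0; x1; x2; x3; x4; x5] in
  forall i j, (i < 6)%N -> (j < 6)%N ->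
  vtype (nth d c i) = vtype x0 (+) odd i /\
  adj (nth d c i) (nth d c j) = ((j == i.+1 %% 6) || (i == j.+1 %% 6))%N.
Proof.
move=> hx c; have [d03 d14 d25] := hexagon_diagonal hx.
case: hx => -[h01 h12 h23] [[h34 h45 h50] _].
have t1 := adj_vtypeE h01; have t2 := adj_vtypeE h12; have t3 := adj_vtypeE h23.
have t4 := adj_vtypeE h34; have t5 := adj_vtypeE h45.
rewrite t1 negbK in t2; rewrite t2 in t3; rewrite t3 negbK in t4; rewrite t4 in t5.
move=> [|[|[|[|[|[|i]]]]]] [|[|[|[|[|[|j]]]]]] // _ _; rewrite /c /=;
  (split; first by rewrite ?t1 ?t2 ?t3 ?t4 ?t5; case: vtype);
  by [rewrite ?h01 ?h12 ?h23 ?h34 ?h45 ?h50 ?d03 ?d14 ?d25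
     |rewrite adj_sym ?h01 ?h12 ?h23 ?h34 ?h45 ?h50 ?d03 ?d14 ?d25
     |apply: adj_same_type; rewrite ?t1 ?t2 ?t3 ?t4 ?t5].
Qed.

Lemma hexagon_closed x0 x1 x2 x3 x4 x5 : hexagon x0 x1 x2 x3 x4 x5 ->
  join_closed [:: x0; x1; x2; x3; x4; x5].
Proof.
move=> hx a b /(nthP x0)[i li <-] /(nthP x0)[j lj <-].
have [-> _] := hexagon_adj x0 hx li li; have [-> _] := hexagon_adj x0 hx lj lj.
move=> ij tij.
have [k lk /andP[ki kj]] : exists2 k, (k < 6)%N &
    ((k == i.+1 %% 6) || (i == k.+1 %% 6)) && ((k == j.+1 %% 6) || (j == k.+1 %% 6)).
  (* Distinct vertices of the same type are two apart: modulo 6 either j = i + 2, with i + 1 in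
     between, or i = j + 2, with j + 1 in between. *)
  exists (if j == (i + 2) %% 6 then (i + 1) %% 6 else (j + 1) %% 6)%N.
    by case: ifP => _; rewrite ltn_mod.
  move: i j li lj ij tij => [|[|[|[|[|[|i]]]]]] [|[|[|[|[|[|j]]]]]] //= _ _ ij;
  by case: vtype => //; case: ij.
exists (nth x0 [:: x0; x1; x2; x3; x4; x5] k); split; first exact: mem_nth.
- by have [_ ->] := hexagon_adj x0 hx li lk.
- by have [_ ->] := hexagon_adj x0 hx lj lk.
Qed.

Lemma hexagon_matched x0 x1 x2 x3 x4 x5 y0 y1 y2 y3 y4 y5 :
  hexagon x0 x1 x2 x3 x4 x5 -> hexagon y0 y1 y2 y3 y4 y5 -> vtype x0 = vtype y0 ->
  matched [:: x0; x1; x2; x3; x4; x5] [:: y0; y1; y2; y3; y4; y5].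
Proof.
move=> hx hy t; split.
  by case: (hx) (hy) => _ [_ ux] [_ [_ uy]]; split=> //; split; apply: hexagon_closed.
move=> d i j li lj.
have [-> ->] := hexagon_adj d hx li lj; have [-> ->] := hexagon_adj d hy li lj.
by rewrite t.
Qed.

(** Distinct vertices of the same type are at distance 2, so a step through a neighbour bounds all
    distances by 3, which opposite vertices of a hexagon attain. The girth is 6 because cycles are
    even and have length other than 4. *)
Lemma projective_plane_gon :
  (forall x y, x <> y -> vtype x = vtype y -> exists z, adj x z /\ adj y z) ->
  (forall x, exists y, adj x y) ->
  (exists x0 x1 x2 x3 x4 x5, hexagon x0 x1 x2 x3 x4 x5) ->
  generalized_gon Gamma 3.
Proof.
move=> J E [x0 [x1 [x2 [x3 [x4 [x5 hx]]]]]].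
have W2 x y : vtype x = vtype y -> exists2 i, (i <= 2)%N & walk i x y.
  have [->|/eqP xy t] := eqVneq x y; first by exists 0%N => //; exists [::].
  have [z [xz yz]] := J x y xy t; exists 2 => //; exists [:: z; y].
  by rewrite /= xz adj_sym yz.
split; split.
- move=> x y; have [t|t] := eqVneq (vtype x) (vtype y).
    have [i i2 /walk_sphere[j ji s]] := W2 x y t.
    by exists j => //; apply: leq_trans ji (leq_trans i2 _).
  have [z yz] := E y.
  have [|i i2 [p [pp lp sp]]] := W2 x z.
    by move: t; rewrite (adj_vtypeE yz); do 2!case: vtype.
  have /walk_sphere[j ji s] : walk i.+1 x y.
    exists (rcons p y); rewrite rcons_path pp lp adj_sym yz last_rcons size_rcons sp.
    by split.
  by exists j => //; apply: leq_trans ji _.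
- exists x0, x3; have [d03 _ _] := hexagon_diagonal hx.
  have [t _] := hexagon_adj x0 hx (i := 3) (j := 0) isT isT; rewrite /= in t.
  case: hx => -[h01 h12 h23] _; split; first by exists [:: x1; x2; x3]; rewrite /= h01 h12 h23.
  case=> [|[|[|//]]] w.
  + by move/walk0: w t => ->; case: vtype.
  + by move/walk1: w; rewrite d03.
  + by move/walk_vtype: w; rewrite t; case: vtype.
- exists [:: x0; x1; x2; x3; x4; x5] => //; split=> //.
  case: hx => -[h01 h12 h23] [[h34 h45 h50] u]; apply/andP; split=> //=.
  by rewrite h01 h12 h23 h34 h45 h50.
- exact: simple_cycle_size.
Qed.

End ProjectivePlanes.
End BipartiteGraphs.

(** * Strong transitivity and the failure of splitting *)

Section MatchedTransitivity.
Variables (Gamma : bipartiteGraph) (G : groupType) (to : graphAction G Gamma).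
Hypothesis c4 : c4free Gamma.
Hypothesis conj : forall s s' : seq Gamma, matched s s' -> exists g, map (to g) s = s'.
Implicit Types (x y z : Gamma) (g h u : G).

Lemma conjugates_strongly_transitive : strongly_transitive to 3.
Proof.
move=> x p y q cp sp cq sq t.
have [x0 [x1 [x2 [x3 [x4 [x5 [ex hx]]]]]]] := simple_hexagon cp sp.
have [y0 [y1 [y2 [y3 [y4 [y5 [ey hy]]]]]]] := simple_hexagon cq sq.
rewrite ex ey; apply/conj/hexagon_matched => //.
by case: ex ey t => -> _ [-> _].
Qed.

Lemma conjugates_vertices x y : vtype x = vtype y -> exists g, to g x = y.
Proof. by move=> t; have [g [gx]] := conj (star_matched (l := [::]) (l' := [::]) t isT isT isT isT erefl); exists g. Qed.

Section Split.
Hypothesis wide : forall x, exists l, [/\ uniq l, size l = 6 & all (adj x) l].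

Lemma fresh_neighbor x (s : seq Gamma) : (size s <= 5)%N -> exists z, adj x z /\ z \notin s.
Proof.
move=> s5; have [l [ul l6 al]] := wide x.
have /hasP[z zl zs] : has (predC (mem s)) l.
  apply/negPn/negP; rewrite -all_predC => /allP h.
  have /(uniq_leq_size ul) : {subset l <= s} by move=> z /h /=; rewrite negbK.
  by rewrite l6 leqNgt ltnS s5.
by exists z; split=> //; apply: (allP al).
Qed.

Lemma generated_subgroup (A : set G) : subgroup (generated A).
Proof.
split=> [H [] //|g h Ag Ah H sH AH|g Ag H sH AH]; have [H1 HM HV] := sH.
  by apply: HM; [apply: Ag|apply: Ah].
by apply: HV; apply: Ag.
Qed.

Lemma generated_normalized (A B : set G) : normalized_by A B -> normalized_by (generated A) B.
Proof.
move=> AB u b Au Bb; have [g1 gM gV] := generated_subgroup A.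
apply: (Au [set g | generated A (g ^ b)]) => [|a Aa H sH AH]; last first.
  exact/AH/AB.
split=> [|g h|g] /=; rewrite ?conj1g ?conjMg ?conjVg //; [exact: gM|exact: gV].
Qed.

Lemma lower_central_sub (U : set G) k : subgroup U -> lower_central U k `<=` U.
Proof.
move=> sU; have [U1 UM UV] := sU.
elim: k => [//|k IH] g /=; apply=> // _ [a [b [/IH Ua Ub ->]]].
rewrite commgEl conjgE; apply: (UM); first exact: UV.
by apply: (UM); [exact: UV|exact: UM].
Qed.

Lemma lower_central_normalized (U B : set G) k :
  normalized_by U B -> normalized_by (lower_central U k) B.
Proof.
move=> nU; elim: k => [//|k IH]; apply: generated_normalized => _ b [a [c [ka Uc ->]]] Bb.
by exists (a ^ b), (c ^ b); split; [apply: IH|apply: nU|rewrite conjRg].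
Qed.

(* Let Om be the set of neighbours of x other than y. If the commutator subgroup [A, U] of a term A
   of the lower central series acts trivially on Om, then on Om the action of A commutes with the
   transitive action of U, so two elements of A that agree at one point of Om agree on Om. If a in A
   moves z, choose b in B fixing z, a z and z1 but not a z1: then b a b^-1 lies in A and agrees with
   a at z but not at z1. So A acts trivially too; descending along the series, U acts trivially on
   Om, against its transitivity. *)
Lemma conjugates_not_split : (forall g x, vtype (to g x) = vtype x) -> ~ split_BN_pair to 3.
Proof.
move=> tot [x [y [p [cp sp]]]] /= [U [UB nU [sU [K UK]] UN]].
have [x0 [x1 [x2 [x3 [x4 [m0 [[e0 e1 ep] hx]]]]]]] := simple_hexagon cp sp.
subst x0 x1; have [d03 _ _] := hexagon_diagonal c4 hx.
have [[xy x12 x23] [[x34 x45 m0x] ux]] := hx.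
have ym0 : m0 <> y.
  by move=> e; move: ux; rewrite e /= !inE eqxx !orbT andbF.
pose B := flag_stabilizer to x y.
pose Om z := adj x z /\ z <> y.
have Om0 : Om m0 by split; rewrite // adj_sym.
have OmB g z : B g -> Om z -> Om (to g z).
  case=> gx gy [xz zy]; split; first by rewrite -{1}gx act_adj.
  by move=> e; apply: zy; apply: (can_inj (actK to g)); rewrite e gy.
have starB l l' : uniq (y :: l) -> uniq (y :: l') -> all (adj x) l -> all (adj x) l' ->
    size l = size l' -> exists b, B b /\ map (to b) l = l'.
  move=> ul ul' al al' e.
  have [|||b [bx by_ bl]] := conj (star_matched (l := y :: l) (l' := y :: l') (erefl (vtype x)) ul ul' _ _ _).
  - by rewrite /= xy.
  - by rewrite /= xy.
  - by rewrite /= e.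
  by exists b.
have UT z : Om z -> exists2 u, U u & to u m0 = z.
  case=> xz /eqP zy.
  have [|||||b [Bb [bz]]] := starB [:: m0] [:: z]; rewrite /= ?inE ?andbT ?xz //.
  - by rewrite eq_sym; apply/eqP.
  - by rewrite eq_sym.
  - by rewrite adj_sym m0x.
  (* As [t] preserves the hexagon and fixes [x] and [y], it fixes the other neighbour [m0] of [x] on
     the hexagon. Hence [u] already takes [m0] to [z], and [U] is transitive on [Om]. *)
  have [u [t [Uu [[tx ty] tc] eb]]] := UN b Bb.
  exists u => //; rewrite -bz eb actM; congr (to u _).
  have xt : adj x (to t m0) by rewrite -{1}tx act_adj adj_sym.
  have := tc (to t m0); rewrite ep map_f; last by rewrite !inE eqxx !orbT.
  move/esym; rewrite !inE => /or4P[/eqP e|/eqP e|/eqP e|].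
  - by rewrite e adj_irrefl in xt.
  - by case: ym0; apply: (can_inj (actK to t)); rewrite e ty.
  - by rewrite adj_same_type ?e // (adj_vtypeE x12) (adj_vtypeE xy) negbK in xt.
  case/or3P => /eqP e //; first by rewrite e d03 in xt.
  by rewrite adj_same_type ?e // -?(adj_vtypeE m0x) (adj_vtypeE m0x) (adj_vtypeE x45) negbK in xt.
have triv k : (forall a z, lower_central U k a -> Om z -> to a z = z) ->
    forall a z, U a -> Om z -> to a z = z.
  elim: k => [//|k IH] Tk; apply: IH => a z ka Oz; apply: contrapT => az.
  have Uk := lower_central_sub (k := k) sU.
  have comm v u w : lower_central U k v -> U u -> Om w -> to v (to u w) = to u (to v w).
    move=> kv Uu Ow; have /Tk/(_ Ow) : lower_central U k.+1 [~ v, u].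
      by move=> H _; apply; exists v, u.
    rewrite commgEl conjgE !actM => e.
    by move: (congr1 (to u) (congr1 (to v) e)); rewrite !actVK => ->.
  have OmU u w : U u -> Om w -> Om (to u w) by move=> /UB; apply: OmB.
  have UT2 w w' : Om w -> Om w' -> exists2 u, U u & to u w = w'.
    have [_ UM UV] := sU.
    move=> /UT[u Uu <-] /UT[u' Uu' <-]; exists (u' * u^-1); first by apply: UM; [|apply: UV].
    by rewrite actM actK.
  have semireg v v' w w' : lower_central U k v -> lower_central U k v' -> Om w -> Om w' ->
      to v w = to v' w -> to v w' = to v' w'.
    move=> kv kv' Ow Ow' e; have [u Uu <-] := UT2 w w' Ow Ow'.
    by rewrite (comm v) // (comm v') // e.
  have Ua := Uk _ ka; have Oaz := OmU _ _ Ua Oz.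
  have UVa : U a^-1 by case: sU => _ _; apply.
  have [z1 [xz1]] := @fresh_neighbor x [:: y; z; to a z; to a^-1 z] isT.
  rewrite !inE !negb_or => /and4P[z1y z1z z1az z1a'z].
  have Oz1 : Om z1 by split=> //; apply/eqP.
  have Oaz1 := OmU _ _ Ua Oz1.
  (* The element [b] will fix the first four neighbours listed after [y], apart from [to a z1],
     which it sends to [z2]. Avoiding five neighbours takes a sixth one. The choice of [z1] outside
     [to a^-1 z] ensures that [to a z1] differs from [z]. *)
  have [z2 [xz2]] := @fresh_neighbor x [:: y; z; to a z; z1; to a z1] isT.
  rewrite !inE !negb_or => /and5P[z2y z2z z2az z2z1 z2az1].
  have az1z : to a z1 != z.
    by apply: contraNneq z1a'z => <-; rewrite actK.
  have az1az : to a z1 != to a z by rewrite (inj_eq (can_inj (actK to a))).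
  have az1z1 : to a z1 != z1.
    (* A fixed point of [a] in [Om] would make [a] trivial on [Om], because [a] commutes there with
       the transitive action of [U]. *)
    apply/eqP => e; apply: az; have [_ UM UV] := sU; have [u Uu uz] := UT2 z1 z Oz1 Oz.
    by rewrite -{1}uz comm // e.
  have az' : to a z != z by apply/eqP.
  have zy : z != y by apply/eqP; case: Oz.
  have azy : to a z != y by apply/eqP; case: Oaz.
  have az1y : to a z1 != y by apply/eqP; case: Oaz1.
  have [|||||b [Bb [bz baz bz1 baz1]]] :=
    starB [:: z; to a z; z1; to a z1] [:: z; to a z; z1; z2].
  - rewrite /= !inE !negb_or !andbT ![y == _]eq_sym zy azy z1y az1y /=.
    by rewrite [z == _]eq_sym az' [z == z1]eq_sym z1z [z == _]eq_sym az1z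
      [_ == z1]eq_sym z1az [to a z == _]eq_sym az1az [z1 == _]eq_sym az1z1.
  - rewrite /= !inE !negb_or !andbT ![y == _]eq_sym zy azy z1y z2y /=.
    by rewrite [z == to a z]eq_sym az' [z == z1]eq_sym z1z [z == _]eq_sym z2z
      [to a z == z1]eq_sym z1az [to a z == _]eq_sym z2az [z1 == _]eq_sym z2z1.
  - by case: Oz Oaz Oz1 Oaz1 => /= -> _ [-> _] [-> _] [-> _].
  - by case: Oz Oaz Oz1 => /= -> _ [-> _] [-> _]; rewrite xz2.
  - by [].
  pose v := a ^ b^-1.
  have kv : lower_central U k v.
    apply: lower_central_normalized nU _ _ ka _.
    by case: Bb => bx by_; split; [rewrite -{1}bx|rewrite -{1}by_]; apply: actK.
  have vE w : to v (to b w) = to b (to a w) by rewrite /v conjgE invgK !actM actK.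
  have vz : to v z = to a z by rewrite -{1}bz vE baz.
  have := semireg v a z z1 kv ka Oz Oz1 vz; rewrite -{1}bz1 vE baz1 => e.
  by rewrite e eqxx in z2az1.
have trivU := triv K.
have [z [xz]] := @fresh_neighbor x [:: y; m0] isT.
rewrite !inE negb_or => /andP[/eqP zy /eqP zm].
have Oz : Om z by [].
have [u Uu uz] := UT z Oz; apply: zm; rewrite -uz; apply: trivU => //.
by move=> a w; rewrite UK => -> _; apply: act1.
Qed.

End Split.
End MatchedTransitivity.

(** * A non-Desarguesian starting configuration *)

Local Open Scope nat_scope.

(* Point lists of the lines. With P, Q, R, S, S', A, B, C, A', B', C' the points 0, 1, 2, 3, 4,
   6, ..., 11, the triangles ABC and A'B'C' are perspective from P, two pairs of sides meet in
   Q and R on the line 0 through P, and this line meets AC and A'C' in distinct points S and S'.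
   The point 5 and the lines 10, 11 only give P and the line 0 six neighbours. *)
Definition config_lines : seq (seq nat) :=
  [:: [:: 0; 1; 2; 3; 4; 5]; [:: 0; 6; 9]; [:: 0; 7; 10]; [:: 0; 8; 11];
      [:: 1; 6; 7]; [:: 1; 9; 10]; [:: 2; 7; 8]; [:: 2; 10; 11];
      [:: 3; 6; 8]; [:: 4; 9; 11]; [:: 0]; [:: 0]]%N.

(** Points are [inl i] and lines are [inr j]; indices from 12 on give isolated vertices. *)
Definition config_adj : rel (nat + nat) := fun x y =>
  match x, y with
  | inl i, inr j | inr j, inl i => i \in nth [::] config_lines j
  | _, _ => false
  end.

Definition config_vtype (x : nat + nat) : bool := if x is inl _ then false else true.

Fact config_adj_sym : symmetric config_adj.
Proof. by case=> i [j|j]. Qed.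

Fact config_adj_vtype x y : config_adj x y -> config_vtype x != config_vtype y.
Proof. by case: x y => i [j|j]. Qed.

Definition configGraph := BipartiteGraph config_adj_sym config_adj_vtype.

Fact config_c4free : c4free configGraph.
Proof.
(* Lines from index 12 on are empty by the default of [nth], which reduces the claim to a finite
   computation. *)
have small i j : i \in nth [::] config_lines j -> j \in iota 0 12.
  by rewrite mem_iota /= add0n; case: (ltnP j 12) => // h; rewrite nth_default.
have key i i' j j' : i \in nth [::] config_lines j -> i \in nth [::] config_lines j' ->
    i' \in nth [::] config_lines j -> i' \in nth [::] config_lines j' -> i = i' \/ j = j'.
  move=> ij ij' i'j i'j'.
  have : all (fun j => all (fun j' => all (fun i => all (fun i' =>
      [==> i \in nth [::] config_lines j', i' \in nth [::] config_lines j' => (i == i') || (j == j')])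
      (nth [::] config_lines j)) (nth [::] config_lines j)) (iota 0 12)) (iota 0 12).
    by vm_compute.
  move=> /allP/(_ j (small _ _ ij))/allP/(_ j' (small _ _ ij'))/allP/(_ i ij)/allP/(_ i' i'j).
  by rewrite ij' i'j' /= => /orP[]/eqP->; auto.
case=> i [i'|i'] [j|j] [j'|j'] //; rewrite /adj /=.
- by move=> h1 h2 h3 h4; case: (key i i' j j' h1 h2 h3 h4) => ->; auto.
- by move=> h1 h2 h3 h4; case: (key j j' i i' h1 h3 h2 h4) => ->; auto.
Qed.

Definition configAction : graphAction (permutation unit) configGraph :=
  @GraphAction (permutation unit) configGraph (fun _ x => x)
    (fun=> erefl) (fun _ _ _ => erefl) (fun _ _ _ => erefl).

Definition configStage : stage := @Stage configGraph _ configAction (fun _ _ => erefl) config_c4free.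

Lemma config_not_moufang (Gamma : bipartiteGraph) (phi : configGraph -> Gamma) :
  c4free Gamma -> injective phi -> {mono phi : x y / adj x y} -> ~ moufang Gamma 3.
Proof.
move=> c4 phi_inj phi_adj M.
pose P (i : nat) : Gamma := phi (inl i); pose L (j : nat) : Gamma := phi (inr j).
have PL i j : (i \in nth [::] config_lines j)%N -> adj (P i) (L j) by rewrite phi_adj.
have LP i j : (i \in nth [::] config_lines j)%N -> adj (L j) (P i) by rewrite adj_sym; apply: PL.
have neq (u v : configGraph) : u != v -> phi u <> phi v by move=> uv /phi_inj/eqP; apply/negP.
have [|||||h [[_ h_adj] h_fix hy]] := M (L 1) [:: P 0; L 0; P 1] _ _ _ (L 4) (L 5).
- by rewrite /= LP // PL // LP.
- by rewrite /= !inE !(inj_eq phi_inj).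
- by [].
- by split; [apply/sphere1/PL|apply: neq].
- by split; [apply/sphere1/PL|apply: neq].
have fixL j : 0 \in nth [::] config_lines j -> h (L j) = L j.
  by move=> j0; apply: (h_fix 1) => //; apply/sphere1/PL.
have fixP i : i \in nth [::] config_lines 0 -> h (P i) = P i.
  by move=> i0; apply: (h_fix 2) => //; apply/sphere1/LP.
have hPL i j : i \in nth [::] config_lines j -> adj (h (P i)) (h (L j)) by rewrite h_adj; apply: PL.
have meet i i' j j' k k' : h (L j) = L k -> h (L j') = L k' -> k != k' ->
    i \in nth [::] config_lines j -> i \in nth [::] config_lines j' ->
    i' \in nth [::] config_lines k -> i' \in nth [::] config_lines k' -> h (P i) = P i'.
  move=> ej ej' kk' ij ij' i'k i'k'; apply: (unique_neighbor c4 (x := L k) (y := L k')).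
  - exact: neq.
  - by rewrite -ej adj_sym hPL.
  - exact: LP.
  - by rewrite -ej' adj_sym hPL.
  - exact: LP.
have line i i' j k m m' : h (P i) = P m -> h (P i') = P m' -> m != m' ->
    i \in nth [::] config_lines j -> i' \in nth [::] config_lines j ->
    m \in nth [::] config_lines k -> m' \in nth [::] config_lines k -> h (L j) = L k.
  move=> ei ei' mm' ij i'j mk m'k; apply: (unique_neighbor c4 (x := P m) (y := P m')).
  - exact: neq.
  - by rewrite -ei hPL.
  - exact: PL.
  - by rewrite -ei' hPL.
  - exact: PL.
have hA : h (P 6) = P 9 by apply: (meet 6 9 1 4 1 5) => //; apply: fixL.
have hB : h (P 7) = P 10 by apply: (meet 7 10 2 4 2 5) => //; apply: fixL.
have hBC : h (L 6) = L 7 by apply: (line 2 7 6 7 2 10) => //; apply: fixP.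
have hC : h (P 8) = P 11 by apply: (meet 8 11 3 6 3 7) => //; apply: fixL.
have hAC : h (L 8) = L 9 by apply: (line 6 8 8 9 9 11).
have S9 : adj (P 3) (L 9) by rewrite -hAC -(fixP 3) // hPL.
have := unique_neighbor c4 (neq (inl 3) (inl 4) isT) S9 (PL 3 0 isT) (PL 4 9 isT) (PL 4 0 isT).
exact: neq.
Qed.

(** * Properties of the limit plane and its group *)

Section MainTheorem.

Let Gamma : bipartiteGraph := limGraph configStage.
Let G : groupType := limGroup configStage.
Let to : graphAction G Gamma := limAction configStage.
Let phi (x : configGraph) : Gamma := embed (n := 0) (x : stage_seq configStage 0).

Let phi_inj : injective phi. Proof. exact: (@embed_inj configStage 0). Qed.
Let phi_adj : {mono phi : x y / adj x y}. Proof. exact: (@embed_adj configStage 0). Qed.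
Let c4 : c4free Gamma. Proof. exact: lim_c4free. Qed.
Let conj (s s' : seq Gamma) : matched s s' -> exists g, map (to g) s = s'.
Proof. exact: lim_conjugates. Qed.

Lemma limit_wide (x : Gamma) : exists l, [/\ uniq l, size l = 6 & all (adj x) l].
Proof.
have [z [l [ul l6 al tz]]] : exists (z : configGraph) (l : seq configGraph),
    [/\ uniq l, size l = 6, all (adj z) l & vtype z = vtype x].
  case: (vtype x).
    by exists (inr 0%N), [seq inl i | i <- [:: 0; 1; 2; 3; 4; 5]%N].
  by exists (inl 0%N), [seq inr i | i <- [:: 0; 1; 2; 3; 10; 11]%N].
have [|g <-] := conjugates_vertices conj (x := phi z) (y := x).
  by rewrite -tz; exact: embed_vtype.
exists (map (to g \o phi) l); split; rewrite ?size_map //.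
  rewrite map_inj_uniq //; exact: inj_comp (can_inj (actK to g)) phi_inj.
by rewrite all_map; apply: sub_all al => y; rewrite -phi_adj -(act_adj to g).
Qed.

Lemma limit_hexagon : exists x0 x1 x2 x3 x4 x5 : Gamma, hexagon x0 x1 x2 x3 x4 x5.
Proof.
(* The triangle Q, A, P with its sides. *)
exists (phi (inl 1%N)), (phi (inr 4%N)), (phi (inl 6%N)), (phi (inr 1%N)), (phi (inl 0%N)), (phi (inr 0%N)).
by rewrite /hexagon !phi_adj /= !inE !(inj_eq phi_inj).
Qed.

Lemma limit_simple : simple_group G.
Proof.
split.
  have [|g e] := conjugates_vertices conj (x := phi (inl 0%N)) (y := phi (inl 1%N)).
    by rewrite /phi /vtype /= !embed_vtype.
  by exists g => g1; move: e; rewrite g1 act1 => /phi_inj.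
move=> N sN nN; have [ex|nex] := pselect (exists2 x, N x & x <> 1%g).
  by right; apply: lim_normal_full.
left; apply/seteqP; split=> [x Nx|_ -> ]; last by case: sN.
by apply: contrapT => x1; apply: nex; exists x.
Qed.

End MainTheorem.

Theorem mainTheorem1 :
  exists (n : nat) (Gamma : bipartiteGraph) (G : groupType)
         (to : graphAction G Gamma),
    [/\ generalized_gon Gamma n,
        simple_group G,
        strongly_transitive to n,
        ~ moufang Gamma n
      & ~ split_BN_pair to n].
Proof.
exists 3, (limGraph configStage), (limGroup configStage), (limAction configStage); split.
- apply: projective_plane_gon limit_hexagon; first exact: lim_c4free.
    exact: lim_joined.
  by move=> x; have [[|y l] [_ // _ /andP[xy _]]] := limit_wide x; exists y.
- exact: limit_simple.
- by apply: conjugates_strongly_transitive; [apply: lim_c4free|apply: lim_conjugates].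
- by apply: (@config_not_moufang _ (@embed configStage 0 : configGraph -> limGraph configStage));
    [apply: lim_c4free|apply: (@embed_inj configStage 0)|apply: (@embed_adj configStage 0)].
- apply: conjugates_not_split; [exact: lim_c4free|exact: lim_conjugates| |exact: limAction_vtype].
  exact: limit_wide.
Qed.
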